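(* For a tree $T$ on $n$ vertices and a positive integer $k$, the $k$-color connection number $cc_k(T)$ can be computed in time linear in $n$.
   Context: For an edge-coloring $f$ of a connected graph $G$ and vertices $u,v$, the color-distance $cd_f(u,v)$ is the minimum number of distinct colors appearing on a $u$–$v$ path ($0$ if $u=v$), and the color-diameter is $cD_f(G)=\max_{u,v}cd_f(u,v)$. An edge-coloring $f$ is a $k$-color connection coloring if $cD_f(G)\le k$, and $cc_k(G)$ is the maximum number of colors used by a $k$-color connection coloring of $G$. *)

(* Defs.v *)
From mathcomp Require Import all_boot.

Set Implicit Arguments.
Unset Strict Implicit.
Unset Printing Implicit Defensive.

(** * Graphs and trees *)

Section Graphs.
Variables (T : finType) (e : rel T).

Definition simple_graph : Prop := symmetric e /\ irreflexive e.

Definition connected_graph : Prop := forall u v, connect e u v.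

(* For symmetric e, [ucycle e [:: u; v]] holds on every edge uv, so the cycles
   of the graph are the ucycles of length at least 3. *)
Definition acyclic_graph : Prop := forall c, ucycle e c -> size c < 3.

Definition is_tree : Prop :=
  [/\ 0 < #|T|, simple_graph, connected_graph & acyclic_graph].

Definition edge_set : {set {set T}} :=
  [set [set p.1; p.2] | p in [set p : T * T | e p.1 p.2]].

(* es lists every edge exactly once, in any order and with its two endpoints
   in any order. *)
Definition edge_list (es : seq (T * T)) : Prop :=
  perm_eq [seq [set p.1; p.2] | p <- es] (enum edge_set).

(** * Color connection *)

(* Colors are natural numbers; only the values of f on [edge_set] matter, and
   f need not be proper. *)
Implicit Type f : {set T} -> nat.

Definition colors_used f : nat :=
  size (undup [seq f E | E <- enum edge_set]).

(* The vertices of the path are u :: p. *)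
Definition path_colors f (u : T) (p : seq T) : nat :=
  size (undup (pairmap (fun x y => f [set x; y]) u p)).

Definition is_path (u v : T) (p : seq T) : bool :=
  [&& path e u p, last u p == v & uniq (u :: p)].

(* A path has fewer than #|T| edges, so the value #|T| of the empty minimum is
   harmless; see [color_distP]. *)
Definition color_dist f (u v : T) : nat :=
  \big[minn/#|T|]_(p : {bseq #|T| of T} | is_path u v p) path_colors f u p.

Definition color_diam f : nat := \max_(u : T) \max_(v : T) color_dist f u v.

Definition color_connection k f : Prop := color_diam f <= k.

Definition is_cc (k m : nat) : Prop :=
  (exists2 f, color_connection k f & colors_used f = m) /\
  (forall f, color_connection k f -> colors_used f <= m).

Lemma is_path_size u v p : is_path u v p -> size p < #|T|.
Proof. by case/and3P=> _ _ /card_uniqP uq; rewrite -[(size p).+1]uq max_card. Qed.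

Lemma color_distP f u v : connect e u v ->
  (exists2 p, is_path u v p & path_colors f u p = color_dist f u v) /\
  (forall p, is_path u v p -> color_dist f u v <= path_colors f u p).
Proof.
move=> /connectP[q0 eq0 ->{v}].
have [q eq uq _] := shortenP eq0; set v := last u q.
have le_cd p : is_path u v p -> color_dist f u v <= path_colors f u p.
  move=> pP; have szp := ltnW (is_path_size pP).
  rewrite /color_dist; have: Bseq szp \in index_enum {bseq #|T| of T}.
    exact: mem_index_enum.
  elim: (index_enum _) => //= b s IHs; rewrite inE big_cons.
  case/predU1P=> [<-|/IHs le_s]; first by rewrite pP geq_minl.
  by case: ifP => // _; apply: leq_trans le_s; apply: geq_minr.
split=> //; have qP : is_path u v q by rewrite /is_path eq eqxx.
have: color_dist f u v = #|T| \/
      exists2 p, is_path u v p & path_colors f u p = color_dist f u v.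
  rewrite /color_dist; elim/big_ind: _ => [|x y Hx Hy|p pP].
  - by left.
  - by case: (leqP x y) => _.
  - by right; exists (p : seq T).
case=> // Ecd; have := le_cd _ qP; rewrite Ecd leqNgt => /negP[].
apply: leq_ltn_trans (is_path_size qP).
by apply: leq_trans (size_undup _) _; rewrite size_pairmap.
Qed.

End Graphs.

(** * Random access machines *)

(* A RAM with immediate, direct and indirect addressing, addition, truncated
   subtraction and conditional jumps, each instruction having unit cost.
   The run below also bounds the contents of every cell, so that with a bound
   polynomial in the input parameters this is the RAM with words of
   logarithmic length. *)

Inductive loc := Dir of nat | Ind of nat.

Inductive operand := Imm of nat | Cell of loc.

Inductive instr :=
| IMov of loc & operand
| IAdd of loc & operand & operand
| ISub of loc & operand & operand
| IJmp of nat
| IJle of operand & operand & nat.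

Definition program := seq instr.

Definition memory := nat -> nat.

Record state := State { st_pc : nat; st_mem : memory }.

Definition upd (m : memory) (a x : nat) : memory :=
  fun b => if b == a then x else m b.

Definition loc_addr (m : memory) (l : loc) : nat :=
  match l with Dir a => a | Ind a => m a end.

Definition operand_val (m : memory) (o : operand) : nat :=
  match o with Imm x => x | Cell l => m (loc_addr m l) end.

Definition exec (i : instr) (s : state) : state :=
  let: State q m := s in
  match i with
  | IMov l x => State q.+1 (upd m (loc_addr m l) (operand_val m x))
  | IAdd l x y => State q.+1 (upd m (loc_addr m l) (operand_val m x + operand_val m y))
  | ISub l x y => State q.+1 (upd m (loc_addr m l) (operand_val m x - operand_val m y))
  | IJmp j => State j m
  | IJle x y j => State (if operand_val m x <= operand_val m y then j else q.+1) m
  end.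

Definition halted (P : program) (s : state) : bool := size P <= st_pc s.

Definition step (P : program) (s : state) : state :=
  if onth P (st_pc s) is Some i then exec i s else s.

Definition start (input : seq nat) : state := State 0 (nth 0 input).

(* Started on the input, P halts after at most [time] steps with [output] in
   cell 0, and no cell ever holds a value exceeding [word]. *)
Definition ram_computes (P : program) (input : seq nat)
    (time word output : nat) : Prop :=
  exists2 t, t <= time &
    [/\ halted P (iter t (step P) (start input)),
        st_mem (iter t (step P) (start input)) 0 = output &
        forall i a, i <= t -> st_mem (iter i (step P) (start input)) a <= word].

Definition tree_input (n k : nat) (es : seq ('I_n * 'I_n)) : seq nat :=
  n :: k :: flatten [seq [:: val p.1; val p.2] | p <- es].

(* Main.v *)
Require Import Defs.
From mathcomp Require Import all_boot zify.

(** Let L be the number of leaves of T. If k >= 3 and T has at least 3 vertices then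
    cc_k(T) = L + cc_{k-2}(T - leaves); moreover cc_2(T) is the maximum degree and
    cc_1(T) is 1 unless T is a single vertex.

    For the lower bound, color the leaf edges with fresh colors; for k = 2, color each
    edge by its component of T - v, where v has maximum degree. For the upper bound,
    pick one representative edge per color. By exchanging representatives one finds a
    vertex v such that a path starting at v has fewer than k/2 representatives after
    its first edge. Deleting, for every leaf, the last representative on the path from
    v to it then gives such a configuration for T - leaves and k - 2.

    The program stores the degree of each vertex and the sum of its neighbours, which
    for a leaf is its only neighbour, so that leaves can be removed one by one from a
    queue without adjacency lists. *)

Set Implicit Arguments.
Unset Strict Implicit.
Unset Printing Implicit Defensive.

(** * Paths in forests *)

(** Deleting representatives leaves a set of edges, not a coloring of the smaller tree, so the upper
    bound cannot go by induction on colorings. It is proved instead for all pairs of an edge set and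
    a vertex [v] that satisfy [center]; a coloring only serves to produce the first such pair. The
    edges at [v] are exempt from the bound on a single branch because, already for k = 2, all edges
    of a star may be representatives. Pairs of branches are therefore bounded separately. Deleting
    last representatives lowers k by 2 for this reason: a branch that keeps a representative extends
    to a leaf, and the last representative before that leaf, which lies on the extended branch, is
    gone. Two branches at [v] thus lose one each. The running time is linear although the number of
    rounds depends on k and on the shape of the tree: a round is paid for by the leaves it removes,
    and every round on more than two vertices removes at least one. *)

Section SimplePaths.
Variable T : finType.
Implicit Types (g : rel T) (u v x y z : T) (p q s : seq T) (S : {set {set T}}).

Definition forest g : Prop := simple_graph g /\ acyclic_graph g.

Definition spath g u p := path g u p && uniq (u :: p).

Definition avoiding g u : rel T := [rel x y | [&& g x y, x != u & y != u]].

Definition cut g a b : rel T := [rel x y | g x y && ([set x; y] != [set a; b])].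

Definition side g a b : {set T} := [set z | connect (cut g a b) b z].

Definition path_edges u p := pairmap (fun x y => [set x; y]) u p.

Definition marks S u p := count (mem S) (path_edges u p).

Lemma path_edges_cat u p q :
  path_edges u (p ++ q) = path_edges u p ++ path_edges (last u p) q.
Proof. exact: pairmap_cat. Qed.

Lemma marks_cat S u p q : marks S u (p ++ q) = marks S u p + marks S (last u p) q.
Proof. by rewrite /marks path_edges_cat count_cat. Qed.

Lemma path_edges_rev u p :
  path_edges (last u p) (rev (belast u p)) = rev (path_edges u p).
Proof.
elim: p u => //= x p IHp u; rewrite rev_cons -cats1 path_edges_cat IHp rev_cons.
rewrite -cats1; congr (_ ++ [:: _]); rewrite setUC; congr [set _; _].
by case: p {IHp} => //= y p; rewrite rev_cons last_rcons.
Qed.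

Lemma mem_path_edges u p E : E \in path_edges u p -> {subset E <= u :: p}.
Proof.
elim: p u => //= x p IHp u; rewrite inE => /predU1P[-> z|/IHp sE z /sE].
  by rewrite !inE => /orP[]/eqP->; rewrite eqxx ?orbT.
by rewrite !inE => ->; rewrite orbT.
Qed.

Lemma notin_path_edges u p x y : x \notin u :: p -> [set x; y] \notin path_edges u p.
Proof. by apply: contra => /mem_path_edges; apply; rewrite !inE eqxx. Qed.

Lemma uniq_path_edges u p : uniq (u :: p) -> uniq (path_edges u p).
Proof.
elim: p u => //= x p IHp u /andP[ux Ux].
by rewrite IHp // andbT; apply: notin_path_edges.
Qed.

Lemma path_edges_sub g u p : path g u p -> {subset path_edges u p <= edge_set g}.
Proof.
elim: p u => //= x p IHp u /andP[gux gp] E; rewrite inE => /predU1P[->|/IHp->] //.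
by apply/imsetP; exists (u, x); rewrite ?inE.
Qed.

Lemma edge_setP g E : reflect (exists x y, g x y /\ E = [set x; y]) (E \in edge_set g).
Proof.
apply: (iffP imsetP) => [[[x y]]|[x [y [gxy ->]]]].
  by rewrite inE /= => gxy ->; exists x, y.
by exists (x, y); rewrite ?inE.
Qed.

Lemma path_colorsE f u p : path_colors f u p = size (undup (map f (path_edges u p))).
Proof.
rewrite /path_colors; congr (size (undup _)).
by elim: p u => //= x p IHp u; rewrite IHp.
Qed.

Lemma size_undup_sub (X : eqType) (s t : seq X) :
  {subset s <= t} -> size (undup s) <= size t.
Proof.
by move=> st; apply: uniq_leq_size (undup_uniq _) _ => x; rewrite mem_undup => /st.
Qed.

Lemma marks_le_colors S (f : {set T} -> nat) u p :
  uniq (u :: p) -> {in S &, injective f} -> marks S u p <= path_colors f u p.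
Proof.
move=> /uniq_path_edges Up injf; rewrite path_colorsE /marks -size_filter -(size_map f).
apply: uniq_leq_size => [|c /mapP[E]].
  rewrite map_inj_in_uniq ?filter_uniq // => E E'.
  by rewrite !mem_filter => /andP[SE _] /andP[SE' _]; apply: injf.
by rewrite mem_filter mem_undup => /andP[_ pE] ->; apply: map_f.
Qed.

Lemma spath_sub (g h : rel T) u p :
  (forall x y, g x y -> h x y) -> spath g u p -> spath h u p.
Proof. by move=> gh /andP[gp up]; rewrite /spath (sub_path gh gp). Qed.

Lemma spathP (g : rel T) u v : connect g u v -> exists2 p, spath g u p & v = last u p.
Proof.
case/connectP=> p gp ->; have [q gq uq _] := shortenP gp.
by exists q; rewrite // /spath gq.
Qed.

Lemma spath_size g u p : spath g u p -> size p <= #|T|.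
Proof. by case/andP=> gp up; apply/ltnW/(is_path_size (e := g) (u := u) (v := last u p)); rewrite /is_path gp eqxx. Qed.

Lemma spath_dec g (P : pred (seq T)) u :
  (exists2 p, spath g u p & P p) \/ (forall p, spath g u p -> ~~ P p).
Proof.
case: (pickP [pred p : {bseq #|T| of T} | spath g u p && P p]) => [p /andP[]|noP].
  by left; exists (p : seq T).
right=> p gp; have := noP (Bseq (spath_size gp)); rewrite /= gp /=.
by move=> ->.
Qed.

Lemma spath_consl g u x p : spath g u (x :: p) -> [/\ g u x, spath g x p & u \notin x :: p].
Proof. by rewrite /spath cons_uniq /= => /and3P[/andP[-> ->] -> ->]. Qed.

Lemma spath_cons g u x p : g u x -> spath g x p -> u \notin x :: p -> spath g u (x :: p).
Proof. by rewrite /spath cons_uniq /= => -> /andP[-> ->] ->. Qed.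

Lemma spath_catl g u p q : spath g u (p ++ q) -> spath g u p.
Proof.
rewrite /spath cat_path -cat_cons cat_uniq => /andP[/andP[-> _] /andP[-> _]] //.
Qed.

Lemma spath_catr g u p q : spath g u (p ++ q) -> spath g (last u p) q.
Proof.
elim: p u => //= x p IHp u /spath_consl[_ + _]; exact: IHp.
Qed.

Lemma avoiding_connect g u x p z :
  path g x p -> u \notin x :: p -> z \in x :: p -> connect (avoiding g u) x z.
Proof.
elim: p x => [|y p IHp] x /=; first by rewrite !inE => _ _ /eqP->.
case/andP=> gxy gp; rewrite inE negb_or => /andP[ux uyp].
rewrite inE => /predU1P[->|zp]; first exact: connect0.
apply: connect_trans (IHp _ gp uyp zp); apply: connect1.
rewrite /avoiding /= gxy eq_sym ux /=.
by apply: contraNneq uyp => ->; rewrite mem_head.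
Qed.

(** * Unique paths, branches at a vertex, and bridges *)

Section Forest.
Variable g : rel T.
Hypothesis gF : forest g.

Let gS : symmetric g := proj1 (proj1 gF).
Let gI : irreflexive g := proj2 (proj1 gF).

Lemma avoiding_sym u : symmetric (avoiding g u).
Proof. by move=> x y; rewrite /avoiding /= gS; congr (_ && _); rewrite andbC. Qed.

Lemma cut_sym a b : symmetric (cut g a b).
Proof. by move=> x y; rewrite /cut /= gS setUC. Qed.

Lemma forest_closed_path u p : spath g u p -> g (last u p) u -> size p <= 1.
Proof.
case/andP=> gp up gl; case: gF => _ /(_ (u :: p)); rewrite /ucycle /= rcons_path gp gl.
by move=> /(_ up).
Qed.

(** A simple path between two distinct neighbours of [u] that misses [u] would close to a cycle
    through [u]. *)
Lemma forest_branch u x y :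
  g u x -> g u y -> connect (avoiding g u) x y -> x = y.
Proof.
move=> gux guy /spathP[p /andP[hp up] yE].
have unp : u \notin x :: p.
  have neu a b : avoiding g u a b -> b != u by case/and3P.
  rewrite inE negb_or; apply/andP; split.
    by apply: contraTneq gux => ->; rewrite gI.
  elim: p {up yE} (x) hp => //= b p IHp a /andP[ab /IHp nu].
  by rewrite inE negb_or eq_sym (neu _ _ ab).
have gp : path g x p by apply: sub_path hp => a b /and3P[].
have gxp : spath g u (x :: p) by apply: spath_cons; rewrite // /spath gp.
have := forest_closed_path gxp; rewrite /= -yE gS => /(_ guy).
by case: p yE {hp up unp gp gxp}.
Qed.

Lemma spath_unique u p q :
  spath g u p -> spath g u q -> last u p = last u q -> p = q.
Proof.
elim: p u q => [|x p IHp] u [|y q] //=.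
- by move=> _ /andP[_ /andP[+ _]] E; rewrite E mem_last.
- by move=> /andP[_ /andP[+ _]] _ E; rewrite -E mem_last.
move=> /spath_consl[gux gp ux] /spath_consl[guy gq uy] E.
suff xy : x = y by rewrite -xy in E gq *; rewrite (IHp x q).
have /andP[ggp _] := gp; have /andP[ggq _] := gq.
apply: (forest_branch gux guy).
apply: connect_trans (avoiding_connect ggp ux (mem_last _ _)) _.
rewrite E (sym_connect_sym (avoiding_sym u)); exact: avoiding_connect ggq uy (mem_last _ _).
Qed.

Lemma spath_disjoint u x p y q : x != y ->
  spath g u (x :: p) -> spath g u (y :: q) -> ~~ has (mem (x :: p)) (y :: q).
Proof.
move=> nxy /spath_consl[gux /andP[gp _] ux] /spath_consl[guy /andP[gq _] uy].
apply: contraNN nxy => /hasP[z zq zp]; apply/eqP/(forest_branch gux guy).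
apply: connect_trans (avoiding_connect gp ux zp) _.
rewrite (sym_connect_sym (avoiding_sym u)); exact: avoiding_connect gq uy zq.
Qed.

(** Distinct branches at [u] are disjoint, so following [q] backwards and then [x :: p] stays
    simple. This turns bounds on single paths into bounds on pairs of branches. *)
Lemma spath_join u x p q :
  spath g u (x :: p) -> spath g u q -> x != head u q ->
  exists v s, spath g v s /\
    forall S, marks S v s = marks S u (x :: p) + marks S u q.
Proof.
move=> gp gq nx; exists (last u q), (rev (belast u q) ++ x :: p); split; last first.
  move=> S; rewrite marks_cat addnC.
  have -> : last (last u q) (rev (belast u q)) = u.
    by case: q {gq nx} => //= y q; rewrite rev_cons last_rcons.
  by rewrite /marks path_edges_rev count_rev.
have Erev : last u q :: rev (belast u q) = rev (u :: q) by rewrite [u :: q]lastI rev_rcons.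
have /andP[gp1 up] := gp; have /andP[gq1 uq] := gq.
rewrite /spath -cat_cons Erev cat_uniq rev_uniq uq cat_path rev_path.
have -> : last (last u q) (rev (belast u q)) = u.
  by case: q {gq nx Erev gq1 uq} => //= y q; rewrite rev_cons last_rcons.
have -> : path (fun z => g^~ z) u q by rewrite (eq_path (e' := g)) // => a b; rewrite gS.
move: up; rewrite cons_uniq => /andP[unp uxp]; rewrite gp1 uxp !andbT; apply/hasPn => z zp.
have {}zp : z \in x :: p by [].
change (z \notin rev (u :: q)).
rewrite mem_rev inE negb_or; apply/andP; split.
  by apply: contraNneq unp => <-.
case: q gq nx {Erev gq1 uq} => // y q gq nx.
have := spath_disjoint nx gp gq; apply: contra => zq; apply/hasP; exists z => //.
Qed.

Lemma bridge a b : g a b -> ~~ connect (cut g a b) a b.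
Proof.
move=> gab; apply/negP => /spathP[p hp bE].
have gp : spath g a p by apply: spath_sub hp => x y /andP[].
have := forest_closed_path gp; rewrite -bE gS gab => /(_ isT).
case: p hp bE gp => [|x [|//]] /=; first by move=> _ E; rewrite E gI in gab.
by move=> /andP[+ _] bx; rewrite /cut /= -bx eqxx andbF.
Qed.

Lemma spath_side a b p : spath g a (b :: p) -> {subset b :: p <= side g a b}.
Proof.
case/spath_consl=> _ /andP[gp _] nab z zp; rewrite inE.
suff {gp nab zp} H x : path g x p -> a \notin x :: p -> z \in x :: p ->
    connect (cut g a b) x z by apply: H.
elim: p x => [|y p IHp] x /=.
  by rewrite !inE => _ _ /eqP->; rewrite connect0.
case/andP=> gxy gp; rewrite inE negb_or => /andP[ax ayp].
rewrite inE => /predU1P[->|zp]; first exact: connect0.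
apply: connect_trans (IHp _ gp ayp zp); apply: connect1; rewrite /cut /= gxy /=.
apply/eqP => /setP/(_ a); rewrite !inE eqxx (negbTE ax) /=.
by case: eqP ayp => // ->; rewrite mem_head.
Qed.

Lemma side_disjoint a b z : g a b -> z \in side g a b -> z \in side g b a -> False.
Proof.
move=> gab; rewrite !inE => Hb Ha; have /negP[] := bridge gab.
have E : cut g b a =2 cut g a b by move=> x y; rewrite /cut /= [[set b; a]]setUC.
rewrite (eq_connect E) in Ha.
by apply: connect_trans Ha _; rewrite (sym_connect_sym (@cut_sym a b)).
Qed.

Lemma side_exit a b y z : g a b ->
  y \in side g b a -> z \notin side g b a -> g y z -> y = a /\ z = b.
Proof.
move=> gab ya nza gyz.
have nb : b \notin side g b a.
  by apply/negP => /(side_disjoint gab)-/(_ _)[]; rewrite inE connect0.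
case: (eqVneq [set y; z] [set b; a]) => [E|ne]; last first.
  move: ya nza; rewrite !inE => ya /negP[]; apply: connect_trans ya (connect1 _).
  by rewrite /cut /= gyz.
have : y \in [set b; a] by rewrite -E !inE eqxx.
rewrite !inE => /orP[]/eqP Ey; first by rewrite -{1}Ey ya in nb.
split=> //; have : z \in [set b; a] by rewrite -E !inE eqxx orbT.
rewrite !inE => /orP[]/eqP // Ez; by rewrite Ey Ez gI in gyz.
Qed.

End Forest.
End SimplePaths.

(** * Centers of colorings *)

(** The last equation makes the number of representatives equal to [colors_used] by a mere
    comparison of sizes. *)
Lemma exists_representatives (X Y : eqType) (f : X -> Y) (l : seq X) :
  exists s : seq X, [/\ uniq s, {subset s <= l}, {in s &, injective f} &
                map f s = undup (map f l)].
Proof.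
elim: l => [|x l [s [us sl inj Es]]]; first by exists [::]; split.
case Hx: (f x \in map f l).
  exists s; split=> //=; last by rewrite Hx.
  by move=> y /sl; rewrite inE => ->; rewrite orbT.
have nfx : f x \notin map f s by rewrite Es mem_undup Hx.
exists (x :: s); split=> /=; last by rewrite Hx Es.
- by rewrite us andbT; apply: contra nfx; apply: map_f.
- by move=> y; rewrite !inE => /predU1P[->|/sl->]; rewrite ?eqxx ?orbT.
- move=> y z; rewrite !inE => /predU1P[->|ys] /predU1P[->|zs] // E.
  + by case/negP: nfx; rewrite E map_f.
  + by case/negP: nfx; rewrite -E map_f.
  + exact: inj.
Qed.

Lemma count_subset (X : eqType) (a b : pred X) (s : seq X) :
  {in s, forall x, a x -> b x} -> count a s <= count b s.
Proof.
elim: s => //= x s IHs ab; apply: leq_add.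
  by have := ab x (mem_head _ _); case: (a x) => // ->.
by apply: IHs => y ys; apply: ab; rewrite inE ys orbT.
Qed.

Section Center.
Variable T : finType.
Implicit Types (g : rel T) (u v x y z : T) (p q : seq T) (S : {set {set T}}).

(** In the first clause the edge from [v] to [x] is not counted. The second clause is the trace of
    the diameter bound on the paths through [v]. *)
Definition center g k S v : Prop :=
  (forall x p, spath g v (x :: p) -> (marks S x p).*2 < k) /\
  (forall x p y q, x != y -> spath g v (x :: p) -> spath g v (y :: q) ->
     marks S v (x :: p) + marks S v (y :: q) <= k).

(** Simple paths in a tree are unique, so there this is [color_connection] without the minimum over
    paths. *)
Definition color_bounded g k (f : {set T} -> nat) : Prop :=
  forall u p, spath g u p -> path_colors f u p <= k.

Variable g : rel T.
Hypothesis gF : forest g.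

Let gS : symmetric g := proj1 (proj1 gF).

(** * Exchanging representatives to find a shallow vertex *)

Section Shrink.
Variables (f : {set T} -> nat) (r : nat).
Hypothesis fr : color_bounded g r.*2.+2 f.

Definition selects S : Prop :=
  [/\ S \subset edge_set g, {in S &, injective f} &
      forall E, E \in edge_set g -> exists2 s, s \in S & f s = f E].

(** [Y] is the region where the vertex is still sought; everything behind its boundary edges is
    known to be shallow. Disjointness keeps representatives that later move to edges inside [Y] from
    landing behind an old boundary edge. *)
Definition confined S (Y : {set T}) : Prop :=
  forall y z, y \in Y -> z \notin Y -> g y z ->
    [disjoint side g y z & Y] /\
    forall p, spath g y (z :: p) -> marks S z p <= r.

Lemma selects_swap S s E : selects S -> s \in S -> E \in edge_set g -> f s = f E ->
  selects (E |: S :\ s) /\ #|E |: S :\ s| = #|S|.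
Proof.
move=> [SE inj cov] sS Eg fsE.
have nE : E \notin S :\ s.
  rewrite !inE; apply/negP => /andP[/eqP nEs ES]; apply: nEs; exact: inj.
split; last by rewrite cardsU1 nE (cardsD1 s S) sS.
split.
- apply/subsetP => F; rewrite !inE => /predU1P[->|/andP[_ FS]] //.
  exact: (subsetP SE).
- move=> F F'; rewrite !inE => /predU1P[->|/andP[nF FS]] /predU1P[->|/andP[nF' FS']] //.
  + by rewrite -fsE => /(inj _ _ sS FS')-E'; rewrite E' eqxx in nF'.
  + by rewrite -fsE => /(inj _ _ FS sS)-E'; rewrite E' eqxx in nF.
  + exact: inj.
- move=> F /cov[t tS ft]; case: (eqVneq t s) => [ts|nts].
    by exists E; rewrite ?setU11 // -fsE -ts.
  by exists t; rewrite // !inE nts tS orbT.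
Qed.

(** If both sides were deep, two paths with [r + 1] marks each, joined through the edge, would carry
    [2r + 3] colors: the edge itself stands for the color of [s], which is not counted on either
    side. *)
Lemma swap_shallow S s a b : selects S -> s \in S -> g a b -> f s = f [set a; b] ->
  (forall p, spath g a (b :: p) -> marks (S :\ s) b p <= r) \/
  (forall p, spath g b (a :: p) -> marks (S :\ s) a p <= r).
Proof.
move=> selS sS gab fs.
have gba : g b a by rewrite gS.
have Eg : [set a; b] \in edge_set g by apply/edge_setP; exists a, b.
have [[_ inj' _] _] := selects_swap selS sS Eg fs.
set S' := [set a; b] |: S :\ s in inj'.
have leS u p : marks (S :\ s) u p <= marks S' u p.
  by apply: sub_count => E /= ES; rewrite in_setU1 ES orbT.
case: (spath_dec g (fun p => (head a p == b) && (r < marks (S :\ s) b (behead p))) a)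
  => [[[|x p1] gp1 /= /andP[/eqP E1 lt1]]|shallow]; last 1 first.
- left=> p gp; rewrite leqNgt; have := shallow _ gp; by rewrite /= eqxx.
- by move: gab; rewrite E1 (proj2 (proj1 gF)).
rewrite {x}E1 in gp1; right=> p2 gp2; rewrite leqNgt; apply/negP => lt2.
have [_ gap2 nb] := spath_consl gp2.
have nhd : b != head a p2.
  apply: contraNneq nb => ->; case: (p2) => [|y p]; rewrite ?mem_head //.
  by rewrite !inE eqxx orbT.
have [v [t [gt Et]]] := spath_join gF gp1 gap2 nhd.
have /andP[_ ut] := gt.
have := leq_trans (marks_le_colors ut inj') (fr gt).
rewrite Et {1}/marks /= setU11 -[count _ _]/(marks S' b p1).
have := leS b p1; have := leS a p2; lia.
Qed.

(** Behind the new boundary edge the depth is bounded by [shallow]. Behind an old one the vertex [a]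
    does not occur, so the new representative is not there and the count can only drop. *)
Lemma confined_swap S s a b (Y : {set T}) :
  confined S Y -> a \in Y -> b \in Y -> g a b ->
  (forall p, spath g a (b :: p) -> marks (S :\ s) b p <= r) ->
  confined ([set a; b] |: S :\ s) (Y :&: side g b a).
Proof.
move=> conf aY bY gab shallow y z; rewrite !in_setI negb_and => /andP[yY ya] zN gyz.
set S' := [set a; b] |: S :\ s.
have leS' (S0 : {set {set T}}) u p : S :\ s \subset S0 -> [set a; b] \notin path_edges u p ->
    marks S' u p <= marks S0 u p.
  move=> sub nab; apply: count_subset => E Ep /=; rewrite in_setU1.
  by case/predU1P=> [EE|/(subsetP sub) //]; rewrite -EE Ep in nab.
case zY: (z \in Y) zN => /= zN.
  have [-> ->] := side_exit gF gab ya zN gyz; split.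
    rewrite disjoints_subset; apply/subsetP => w wab; rewrite !inE negb_and.
    apply/orP; right; apply/negP => wba; apply: (side_disjoint gF gab wab).
    by rewrite inE.
  move=> p gp; have [_ _ na] := spath_consl gp.
  by apply: leq_trans (shallow _ gp); apply: leS' => //; apply: notin_path_edges.
have [disj le_r] := conf y z yY (negbT zY) gyz; split.
  by apply: disjointWr disj; apply: subsetIl.
move=> p gp; apply: leq_trans (le_r _ gp); apply: leS'; first exact: subsetDl.
apply: notin_path_edges; apply/negP => ap.
have := spath_side gp ap; move: disj; rewrite disjoint_sym => /disjointFr-/(_ _ aY).
by move=> ->.
Qed.

(* Starting from all vertices, cut the current region at an edge inside it and
   keep the side from which the other one looks shallow, after making that edge
   the representative of its color. *)
Lemma exists_shallow_root S : 0 < #|T| -> selects S ->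
  exists S' v, [/\ selects S', #|S'| = #|S| &
    forall x p, spath g v (x :: p) -> marks S' x p <= r].
Proof.
move=> T_gt0 selS; pose Y := [set: T].
have Y_gt0 : 0 < #|Y| by rewrite cardsT.
have conf : confined S Y by move=> y z _; rewrite inE.
have [n le_n] := ubnP #|Y|.
elim: n Y S selS Y_gt0 conf le_n => // n IHn Y S selS Y_gt0 conf le_n.
case: (pickP [pred ab : T * T | [&& ab.1 \in Y, ab.2 \in Y & g ab.1 ab.2]])
    => [[a b] /and3P[/= aY bY gab]|noE]; last first.
  (* In a region without inner edges every edge at [v] is a boundary edge, so [confined] gives the
     bound in all directions. *)
  case/card_gt0P: Y_gt0 => v vY; exists S, v; split=> // x p gp.
  have [gvx _ _] := spath_consl gp; have := noE (v, x); rewrite /= vY gvx andbT /=.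
  by move=> /negbT xY; have [_ ->] := conf v x vY xY gvx.
wlog [s [sS fs shallow]] : a b aY bY gab / exists s, [/\ s \in S, f s = f [set a; b] &
    forall p, spath g a (b :: p) -> marks (S :\ s) b p <= r].
  move=> W; have [s sS fs] : exists2 s, s \in S & f s = f [set a; b].
    by case: selS => _ _; apply; apply/edge_setP; exists a, b.
  have [sh|sh] := swap_shallow selS sS gab fs; first by apply: (W a b) => //; exists s.
  apply: (W b a) => //; first by rewrite gS.
  by exists s; rewrite [[set b; a]]setUC.
have Eg : [set a; b] \in edge_set g by apply/edge_setP; exists a, b.
have [selS' cardS'] := selects_swap selS sS Eg fs.
rewrite -cardS'; apply: (IHn (Y :&: side g b a)) => //.
- by apply/card_gt0P; exists a; rewrite !inE aY connect0.
- exact: confined_swap.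
apply: leq_trans (_ : #|Y| <= n); last by rewrite -ltnS.
apply: proper_card.
apply/properP; split; first exact: subsetIl.
exists b => //; rewrite in_setI bY /=; apply/negP => /(side_disjoint gF gab)-/(_ _)[].
by rewrite inE connect0.
Qed.

End Shrink.

Lemma exists_center k f : 0 < #|T| -> 0 < k -> color_bounded g k f ->
  exists S v, [/\ S \subset edge_set g, #|S| = colors_used g f & center g k S v].
Proof.
move=> T_gt0 k_gt0 fk.
have [s [us sE inj Es]] := exists_representatives f (enum (edge_set g)).
have selS : selects f [set E in s].
  split.
  - by apply/subsetP => E; rewrite inE => /sE; rewrite mem_enum.
  - by move=> E E'; rewrite !inE; apply: inj.
  - move=> E Eg; have : f E \in map f s by rewrite Es mem_undup map_f ?mem_enum.
    by case/mapP=> E' E's ->; exists E'; rewrite ?inE.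
(* The largest [r] with [2r < k], as the first clause of [center] demands; it still satisfies
   [k <= 2r + 2]. *)
pose r := k.-1./2.
have kr : k <= r.*2.+2 by rewrite /r; lia.
have fr : color_bounded g r.*2.+2 f by move=> u p /fk/leq_trans; apply.
have [S [v [[SE injS _] cS shallow]]] := exists_shallow_root fr T_gt0 selS.
exists S, v; split=> //.
  by rewrite cS cardsE (card_uniqP us) /colors_used -Es size_map.
split=> [x p /shallow|x p y q nxy gp gq]; first by rewrite /r; lia.
have [u [t [gt <-]]] := spath_join gF gp gq nxy.
have /andP[_ ut] := gt; exact: leq_trans (marks_le_colors ut injS) (fk _ _ gt).
Qed.

End Center.

(** * Peeling the leaves *)

Lemma forest_nbr_on_path (T : finType) (g : rel T) (v w z : T) p : forest g ->
  spath g v (rcons p z) -> w \in v :: rcons p z -> g z w -> w = last v p.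
Proof.
move=> gF gp wp gzw; have nwz : w != z.
  by apply: contraTneq gzw => ->; rewrite (proj2 (proj1 gF)).
have {}wp : w \in v :: p.
  by move: wp; rewrite -rcons_cons mem_rcons inE (negbTE nwz).
case/splitPl: wp gp => p1 p2 wE; rewrite rcons_cat => /spath_catr.
rewrite wE => gp2; have := forest_closed_path gF gp2.
rewrite last_rcons size_rcons => /(_ gzw); case: p2 {gp2} => // _.
by rewrite cats0.
Qed.

Section Peeling.
Variables (T : finType) (e : rel T).
Hypothesis eF : forest e.
Implicit Types (A B : {set T}) (u v w x y z : T) (p q : seq T) (S : {set {set T}}).

Let eS : symmetric e := proj1 (proj1 eF).
Let eI : irreflexive e := proj2 (proj1 eF).

(** All trees of the recursion live on subsets of one vertex type, so that peeling only changes
    [A]. *)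
Definition induced A : rel T := [rel x y | [&& x \in A, y \in A & e x y]].

Definition nbrs A x := [set y in A | e x y].

Definition leaves A := [set x in A | #|nbrs A x| == 1].

Definition peel A := A :\: leaves A.

Definition subtree A : Prop :=
  0 < #|A| /\ {in A &, forall x y, connect (induced A) x y}.

Lemma induced_forest A : forest (induced A).
Proof.
split; last first.
  move=> c /andP[cyc uc]; case: eF => _; apply; rewrite /ucycle uc andbT.
  by apply: sub_cycle cyc => x y /and3P[].
split=> x; rewrite /induced /= ?eI ?andbF // => y.
by rewrite eS andbCA.
Qed.

Lemma path_induced A x p : path (induced A) x p -> {subset p <= A}.
Proof.
elim: p x => //= y p IHp x /andP[/and3P[_ yA _] /IHp sA] z.
by rewrite inE => /predU1P[->|/sA].
Qed.

Lemma induced_subset A B x y : A \subset B -> induced A x y -> induced B x y.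
Proof.
by move=> AB /and3P[xA yA exy]; apply/and3P; split=> //; apply: (subsetP AB).
Qed.

Lemma leaf_nbr A x y z : x \in leaves A -> induced A x y -> induced A x z -> y = z.
Proof.
rewrite inE => /andP[_ /cards1P[w Ew]] /and3P[_ yA exy] /and3P[_ zA exz].
have : y \in nbrs A x by rewrite inE yA.
have : z \in nbrs A x by rewrite inE zA.
by rewrite Ew !inE => /eqP-> /eqP->.
Qed.

(** If the end is not a leaf, it has a neighbour besides its predecessor, and this one is off the
    path because there are no cycles. Simple paths have bounded length, so the prolongation
    stops. *)
Lemma spath_extend A v x p : spath (induced A) v (x :: p) ->
  exists q, spath (induced A) v (x :: p ++ q) /\ last x (p ++ q) \in leaves A.
Proof.
have iF := induced_forest A; have iS := proj1 (proj1 iF).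
have [n le_n] := ubnP (#|T| - size p); elim: n p le_n => // n IHn p le_n gp.
case: (boolP (last x p \in leaves A)) => [leaf|nleaf]; first by exists [::]; rewrite cats0.
case/lastP E: {1}(x :: p) => [//|p0 z].
have zE : last x p = z by rewrite -(last_cons v) E last_rcons.
have gl : induced A z (last v p0).
  by move: gp; rewrite iS E /spath rcons_path => /andP[/andP[]].
have [zA _ _] := and3P gl.
have [w iw nw] : exists2 w, induced A z w & w != last v p0.
  move: nleaf; rewrite zE inE zA /= => /negP n1.
  case: (pickP [pred w | (w \in nbrs A z) && (w != last v p0)]) => [w|no].
    rewrite /= inE => /andP[/andP[wA ezw] nw]; exists w => //; exact/and3P.
  case: n1; apply/cards1P; exists (last v p0); apply/setP => w; rewrite in_set1.
  have := no w; rewrite /=; case: eqP => [-> _|_]; last by rewrite andbT.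
  by case/and3P: gl => _ lA el; rewrite inE lA.
have wN : w \notin v :: x :: p.
  apply: contraNN nw => wp; apply/eqP; apply: (forest_nbr_on_path iF (z := z)) => //.
    by rewrite -E.
  by rewrite -E.
have gpw : spath (induced A) v (x :: rcons p w).
  rewrite -rcons_cons /spath rcons_path -rcons_cons rcons_uniq wN.
  by case/andP: gp => -> ->; rewrite -zE in iw; rewrite /= iw.
have [|q [gq lq]] := IHn (rcons p w) _ gpw.
  have := spath_size gpw; rewrite /= size_rcons; move: le_n; move: #|T| => c; lia.
by exists (w :: q); rewrite -cat_rcons.
Qed.

Lemma subtree_spath A x y : subtree A -> x \in A -> y \in A ->
  exists2 p, spath (induced A) x p & y = last x p.
Proof. by case=> _ cA xA yA; apply: spathP; apply: cA. Qed.

Lemma subtree_nbr A x : subtree A -> 1 < #|A| -> x \in A -> exists y, induced A x y.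
Proof.
move=> tA A2 xA; have [y yA nyx] : exists2 y, y \in A & y != x.
  move: A2; rewrite (cardsD1 x) xA ltnS => /card_gt0P[y].
  by rewrite !inE => /andP[nyx yA]; exists y.
have [[|z p] gp yE] := subtree_spath tA xA yA; first by rewrite yE eqxx in nyx.
by exists z; case: (spath_consl gp).
Qed.

(** Two adjacent leaves would cut themselves off from any third vertex. *)
Lemma leaf_nbr_peel A x y : subtree A -> 2 < #|A| -> x \in leaves A ->
  induced A x y -> y \in peel A.
Proof.
move=> tA A3 xl ixy; have iF := induced_forest A; have iS := proj1 (proj1 iF).
have [xA yA _] := and3P ixy; rewrite inE yA andbT; apply/negP => yl.
have [z zA nz] : exists2 z, z \in A & z \notin [set x; y].
  apply/subsetPn; apply: contraL A3 => /subset_leq_card le.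
  by rewrite -leqNgt (leq_trans le) // cards2; case: (_ != _).
have [[|a p] gp zE] := subtree_spath tA xA zA; first by rewrite zE !inE eqxx in nz.
have [ixa gp1 xN] := spath_consl gp; have Ea := leaf_nbr xl ixa ixy.
rewrite {a ixa}Ea in gp gp1 xN zE.
case: p gp gp1 xN zE => [|b p] gp gp1 xN zE; first by rewrite zE !inE eqxx orbT in nz.
have [iyb _ _] := spath_consl gp1; have iyx : induced A y x by rewrite iS.
by rewrite -(leaf_nbr yl iyb iyx) !inE eqxx orbT in xN.
Qed.

Lemma spath_interior A v p x q : spath (induced A) v (rcons p x ++ q) -> q != [::] ->
  x \notin leaves A.
Proof.
case: q => // y q gp _; apply/negP => xl; have iS := proj1 (proj1 (induced_forest A)).
have gr := spath_catr gp; rewrite last_rcons in gr.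
have [ixy _ _] := spath_consl gr.
have /andP[pr _] := spath_catl gp; rewrite rcons_path in pr.
have /andP[_] := pr; rewrite iS => ixl; have E := leaf_nbr xl ixl ixy.
have /andP[_] := gp; rewrite -cat_cons cat_uniq -rcons_cons has_sym => /and3P[_ + _].
case/hasP; exists y; rewrite ?mem_head // -E mem_rcons inE mem_last orbT //.
Qed.

Lemma peel_subset A : peel A \subset A.
Proof. exact: subsetDl. Qed.

Lemma peel_spath A v p : v \in peel A -> last v p \in peel A ->
  spath (induced A) v p -> spath (induced (peel A)) v p.
Proof.
move=> vP lP gp; have /andP[ip up] := gp; rewrite /spath up andbT.
have pP : {in p, forall x, x \in peel A}.
  move=> x xp; case: (eqVneq x (last v p)) => [->//|nx].
  rewrite inE (path_induced ip) // andbT; move: nx gp.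
  case/splitPr: xp => p1 p2; rewrite -cat_rcons => nx gp.
  apply: (spath_interior gp); apply: contra nx => /eqP->.
  by rewrite cats0 last_rcons.
elim: p v vP ip pP {lP gp up} => //= y p IHp v vP /andP[/and3P[_ _ evy] ip] pP.
have yP := pP y (mem_head _ _); rewrite IHp // ?andbT; first exact/and3P.
by move=> x xp; apply: pP; rewrite inE xp orbT.
Qed.

Lemma subtree_peel A : subtree A -> 2 < #|A| -> subtree (peel A).
Proof.
move=> tA A3; split; last first.
  move=> x y xP yP; have xA := subsetP (peel_subset A) x xP.
  have [p gp yE] := subtree_spath tA xA (subsetP (peel_subset A) y yP).
  rewrite yE; apply/connectP; exists p => //; rewrite yE in yP.
  by case/andP: (peel_spath xP yP gp).
have [/card_gt0P[x xA] _] := tA; apply/card_gt0P.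
case: (boolP (x \in leaves A)) => [xl|nxl]; last by exists x; rewrite inE nxl.
have [y ixy] := subtree_nbr tA (ltnW A3) xA; exists y; exact: leaf_nbr_peel ixy.
Qed.

Lemma subtree_has_leaf A : subtree A -> 1 < #|A| -> 0 < #|leaves A|.
Proof.
move=> tA A2; have [/card_gt0P[x xA] _] := tA; have [y ixy] := subtree_nbr tA A2 xA.
have gp : spath (induced A) x [:: y].
  rewrite /spath /= ixy !andbT inE; apply: contraTneq ixy => ->.
  by rewrite (proj2 (proj1 (induced_forest A))).
by have [q [_ lq]] := spath_extend gp; apply/card_gt0P; exists (last y ([::] ++ q)).
Qed.

(** With the tree rooted at [v], [z] is the end of the edge farther from the root. *)
Lemma subtree_edge_end A v E : subtree A -> v \in A -> E \in edge_set (induced A) ->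
  exists p z, spath (induced A) v (rcons p z) /\ E = [set last v p; z].
Proof.
move=> tA vA /edge_setP[y [z [iyz ->]]]; have iF := induced_forest A.
have iS := proj1 (proj1 iF); have [yA zA _] := and3P iyz.
have [p gp yE] := subtree_spath tA vA yA.
case: (boolP (z \in v :: p)) => [zp|nzp]; last first.
  exists p, z; rewrite yE; split=> //; case/andP: gp => ip up.
  by rewrite /spath rcons_path ip -yE iyz -rcons_cons rcons_uniq nzp.
case/lastP: p gp yE zp => [|p w] gp; rewrite ?last_rcons.
  by move=> /= yE; rewrite inE => /eqP zE; rewrite yE zE (proj2 (proj1 iF)) in iyz.
move=> yE zp; rewrite -yE in gp zp *; exists p, y; split=> //.
by rewrite (forest_nbr_on_path iF gp zp iyz) setUC.
Qed.

(** The default [set0] is not an edge, so deleting it from a set of edges has no effect. *)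
Definition last_mark S v p := last set0 [seq E <- path_edges v p | E \in S].

(** A mark surviving in [q] places the last mark of the whole path in [q] as well; belonging to [R],
    that one is lost. *)
Lemma marks_last_mark S (R : {set {set T}}) v p q :
  0 < marks (S :\: R) (last v p) q -> last_mark S v (p ++ q) \in R ->
  marks (S :\: R) (last v p) q < marks S (last v p) q.
Proof.
rewrite /last_mark path_edges_cat filter_cat last_cat /marks -!size_filter.
set s := path_edges _ q => has1 lR.
have sub : {subset [seq E <- s | E \in S :\: R] <= [seq E <- s | E \in S]}.
  by move=> E; rewrite !mem_filter !inE => /andP[/andP[_ ->]].
have : last set0 [seq E <- s | E \in S] \in [seq E <- s | E \in S].
  case: [seq E <- s | E \in S] sub => [|E t _]; last by rewrite /= mem_last.
  case: [seq E <- s | E \in _] has1 => // E t _ /(_ E); rewrite mem_head.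
  by move=> /(_ isT).
have {}lR : last set0 [seq E <- s | E \in S] \in R.
  case: [seq E <- s | E \in S] sub lR => [|E t] //.
  by case: [seq E <- s | E \in _] has1 => // E t _ /(_ E); rewrite mem_head => /(_ isT).
move=> inl; rewrite !size_filter; move: inl lR; move: (last _ _) => L.
rewrite mem_filter => /andP[LS Ls] LR; rewrite -!size_filter.
case/splitPr: Ls => s1 s2; rewrite !filter_cat !size_cat /= LS inE LR /= addnS ltnS.
by apply: leq_add; rewrite !size_filter; apply: sub_count => E; rewrite /= inE => /andP[].
Qed.

(** * Deleting the last representative before each leaf *)

Section PeelCenter.
Variables (A : {set T}) (k : nat) (S : {set {set T}}) (v : T).
Hypotheses (k3 : 2 < k) (cS : center (induced A) k S v).

Let iF := induced_forest A.

Definition branch_path z : seq T :=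
  odflt [::] (omap val [pick p : {bseq #|T| of T} | spath (induced A) v p && (last v p == z)]).

Lemma branch_pathE p : spath (induced A) v p -> branch_path (last v p) = p.
Proof.
move=> gp; rewrite /branch_path; case: pickP => [q /andP[gq /eqP lq]|no] /=.
  by apply: (spath_unique iF gq gp).
by have := no (Bseq (spath_size gp)); rewrite /= gp eqxx.
Qed.

Definition last_marks := [set last_mark S v (branch_path z) | z in leaves A :\ v].

Definition inner_marks := S :\: last_marks.

Lemma card_inner_marks : #|S| <= #|inner_marks| + #|leaves A :\ v|.
Proof.
rewrite -(cardsID last_marks S) addnC leq_add2l.
apply: leq_trans (leq_imset_card _ _); apply: subset_leq_card; exact: subsetIr.
Qed.

(** The path is prolonged to a leaf other than [v]. The last mark on the way to that leaf was
    deleted, and the surviving mark in [q] shows that it lies behind [p]; hence the strict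
    inequality. *)
Lemma marks_extend p q : spath (induced A) v (p ++ q) ->
  0 < marks inner_marks (last v p) q ->
  exists q', spath (induced A) v (p ++ q ++ q') /\
    marks inner_marks (last v p) q < marks S (last v p) (q ++ q').
Proof.
move=> gp m0; have [q' [gq lq]] : exists q', spath (induced A) v (p ++ q ++ q') /\
    last v (p ++ q ++ q') \in leaves A :\ v.
  case Epq: (p ++ q) gp => [|x t] gp.
    by move: Epq m0; case: (p) => //; case: (q).
  have [q' [gq lq]] := spath_extend gp; exists q'; rewrite catA Epq; split=> //.
  rewrite in_setD1 lq andbT; apply/eqP => lv; have [_ _] := spath_consl gq.
  by move: (mem_last x (t ++ q')); rewrite (lv : last x (t ++ q') = v) => ->.
exists q'; split=> //.
have le : marks inner_marks (last v p) q <= marks inner_marks (last v p) (q ++ q').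
  by rewrite marks_cat leq_addr.
apply: leq_ltn_trans le _; apply: marks_last_mark.
  by rewrite marks_cat addn_gt0 m0.
by apply/imsetP; exists (last v (p ++ q ++ q')); rewrite ?branch_pathE.
Qed.

Lemma inner_shallow x p : spath (induced A) v (x :: p) ->
  (marks inner_marks x p).*2 < k - 2.
Proof.
move=> gp; case: (posnP (marks inner_marks x p)) => [->|m0]; first by lia.
have [q' [gq lt]] := marks_extend (p := [:: x]) gp m0.
by have := cS.1 _ _ gq; move: lt => /=; lia.
Qed.

Lemma inner_center : center (induced A) (k - 2) inner_marks v.
Proof.
split=> [|x p y q nxy gp gq]; first exact: inner_shallow.
have sp := inner_shallow gp; have sq := inner_shallow gq.
have le1 z t : marks inner_marks v (z :: t) <= (marks inner_marks z t).+1.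
  by rewrite /marks /= -add1n leq_add2r; case: (_ \in _).
(* If one branch keeps no mark, the other has at most one mark more than its depth bound, which is
   enough since [k > 2]. If both keep a mark, both have lost one. *)
case: (posnP (marks inner_marks v (x :: p))) => [->|mp].
  by have := le1 y q; lia.
case: (posnP (marks inner_marks v (y :: q))) => [->|mq].
  by have := le1 x p; lia.
have [p' [gp' ltp]] := marks_extend (p := [::]) gp mp.
have [q' [gq' ltq]] := marks_extend (p := [::]) gq mq.
have le_k : marks S v ((x :: p) ++ p') + marks S v ((y :: q) ++ q') <= k.
  exact: cS.2 nxy gp' gq'.
rewrite [last v _]/= in ltp ltq; lia.
Qed.

Hypotheses (tA : subtree A) (vA : v \in A) (SA : S \subset edge_set (induced A)).

(** A marked edge ending in a leaf [z] other than [v] is itself the last mark before [z], hence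
    deleted. Only the edge at [v] can escape, when [v] is a leaf. *)
Lemma inner_marks_peel E : E \in inner_marks -> (v \in E -> v \notin leaves A) ->
  E \in edge_set (induced (peel A)).
Proof.
rewrite inE => /andP[nR ES] vE; have EA := subsetP SA E ES.
have [p [z [gp EE]]] := subtree_edge_end tA vA EA.
have ipz : induced A (last v p) z.
  by case/andP: gp; rewrite rcons_path => /andP[].
have [lA zA elz] := and3P ipz.
have nzl : z \notin leaves A.
  apply: contra nR => zl; apply/imsetP; exists z.
    rewrite in_setD1 zl andbT; case/andP: gp => _; rewrite -rcons_cons rcons_uniq.
    by rewrite inE negb_or => /andP[/andP[]].
  have := branch_pathE gp; rewrite last_rcons => ->.
  rewrite /last_mark -cats1 path_edges_cat filter_cat /= -EE ES.
  by rewrite cats1 last_rcons.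
have nll : last v p \notin leaves A.
  case/lastP: p gp EE {ipz lA elz} => [|p w] gp EE; first by rewrite vE // EE !inE eqxx.
  rewrite last_rcons; rewrite -cats1 in gp; exact: (spath_interior gp).
apply/edge_setP; exists (last v p), z; split=> //.
by apply/and3P; rewrite !in_setD nzl nll.
Qed.

End PeelCenter.

Lemma center_subset (g h : rel T) k S S' v : (forall x y, h x y -> g x y) ->
  S' \subset S -> center g k S v -> center h k S' v.
Proof.
move=> hg sub [c1 c2]; have le u p : marks S' u p <= marks S u p.
  by apply: sub_count => E /(subsetP sub).
split=> [x p gp|x p y q nxy gp gq].
  have := c1 x p (spath_sub hg gp); have := le x p; lia.
have := c2 x p y q nxy (spath_sub hg gp) (spath_sub hg gq).
have := le v (x :: p); have := le v (y :: q); lia.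
Qed.

Definition center_bound A k m : Prop := forall S v,
  v \in A -> S \subset edge_set (induced A) -> center (induced A) k S v -> #|S| <= m.

(** When [v] is a leaf, the center moves to its neighbour [w] and the edge between them is given up
    as well. The count still works because [v] is a leaf for which no mark was deleted. *)
Lemma center_bound_peel A k m : subtree A -> 2 < #|A| -> 2 < k ->
  center_bound (peel A) (k - 2) m -> center_bound A k (m + #|leaves A|).
Proof.
move=> tA A3 k3 bnd S v vA SA cS; have card1 := card_inner_marks A S v.
have c1 := inner_center k3 cS.
have subP x y : induced (peel A) x y -> induced A x y.
  exact: induced_subset (peel_subset A).
case: (boolP (v \in leaves A)) => [vl|nvl]; last first.
  rewrite (cardsD1 v (leaves A)) (negbTE nvl) add0n.
  have := bnd (inner_marks A S v) v; rewrite in_setD nvl vA => /(_ isT) {}bnd.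
  apply: leq_trans card1 _; rewrite leq_add2r; apply: bnd.
    by apply/subsetP => E Ei; apply: (inner_marks_peel tA vA SA Ei).
  exact: center_subset subP (subxx _) c1.
have [w ivw] := subtree_nbr tA (ltnW A3) vA.
have wP := leaf_nbr_peel tA A3 vl ivw.
(* Seen from [v], the first edge is the one to [w], so the depth bound at [v] covers paths from [w]
   entirely, their own first edges included. *)
have lift x p : spath (induced (peel A)) w (x :: p) -> spath (induced A) v (w :: x :: p).
  move=> gp; apply: spath_cons => //; first exact: spath_sub gp.
  case/andP: gp => /path_induced sub _; apply/negP; rewrite inE => /predU1P[E|/sub].
    by move: wP; rewrite -E in_setD vl.
  by rewrite in_setD vl.
pose S' := inner_marks A S v :\ [set v; w].
have : #|S'| <= m.
  apply: (bnd S' w) => //.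
    apply/subsetP => E; rewrite in_setD1 => /andP[nE Ei].
    apply: (inner_marks_peel tA vA SA Ei) => vE; case/negP: nE.
    have /edge_setP[x [y [ixy EE]]] : E \in edge_set (induced A).
      by apply: (subsetP SA); move: Ei; rewrite inE => /andP[].
    have iS := proj1 (proj1 (induced_forest A)).
    move: vE ixy; rewrite EE !inE => /orP[]/eqP <- ixy; last first.
      by rewrite iS in ixy; rewrite (leaf_nbr vl ivw ixy) setUC.
    by rewrite (leaf_nbr vl ivw ixy).
  have le u p : marks S' u p <= marks (inner_marks A S v) u p.
    by apply: sub_count => E /=; rewrite in_setD1 => /andP[].
  have sh x p : spath (induced (peel A)) w (x :: p) -> (marks S' w (x :: p)).*2 < k - 2.
    by move=> /lift/(inner_shallow k3 cS); have := le w (x :: p); lia.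
  split=> [x p /sh|x p y q _ /sh + /sh]; last by lia.
  by rewrite /marks /=; lia.
rewrite /S'; have := cardsD1 [set v; w] (inner_marks A S v).
move: card1; rewrite (cardsD1 v (leaves A)) vl /=.
have := leq_b1 ([set v; w] \in inner_marks A S v).
move: (nat_of_bool _) #|_ :\ [set v; w]| #|inner_marks A S v| #|leaves A :\ v| #|S| => b c1' c2' c3 c4.
lia.
Qed.

End Peeling.

(** * Values of the color connection number *)

Section Values.
Variables (T : finType) (e : rel T).
Hypothesis eF : forest e.
Implicit Types (A B : {set T}) (u v w x y z : T) (p q : seq T) (S : {set {set T}}).

Let eS : symmetric e := proj1 (proj1 eF).
Let eI : irreflexive e := proj2 (proj1 eF).

Notation induced := (induced e).
Notation nbrs := (nbrs e).
Notation leaves := (leaves e).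
Notation peel := (peel e).
Notation subtree := (subtree e).

Definition colorable A k m : Prop :=
  exists f, color_bounded (induced A) k f /\ m <= colors_used (induced A) f.

(** The upper half speaks of marked edge sets rather than colorings, the form that is stable under
    peeling; [exists_center] brings it back to colorings. *)
Definition cc_value A k m : Prop := center_bound e A k m /\ colorable A k m.

Definition maxdeg A := \max_(x in A) #|nbrs A x|.

Lemma colors_used_ge (g : rel T) (f : {set T} -> nat) (s : seq nat) : uniq s ->
  {in s, forall c, exists2 E, E \in edge_set g & f E = c} -> size s <= colors_used g f.
Proof.
move=> us sub; apply: uniq_leq_size us _ => c /sub[E Eg <-].
by rewrite mem_undup map_f // mem_enum.
Qed.

Lemma size_undup_ends (c1 c2 : nat) s : size (undup (c1 :: rcons s c2)) <= (size (undup s)).+2.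
Proof.
apply: (@size_undup_sub _ _ (c1 :: c2 :: undup s)) => x.
by rewrite !inE mem_rcons inE mem_undup.
Qed.

(** * Fresh colors on the leaf edges *)

Section FreshLeaves.
Variables (A : {set T}) (f : {set T} -> nat).

Definition fresh := (\max_E f E).+1.

Definition fresh_leaves (E : {set T}) : nat :=
  if [pick z in leaves A | z \in E] is Some z then fresh + enum_rank z else f E.

Lemma fresh_leaves_peel E : E \in edge_set (induced (peel A)) -> fresh_leaves E = f E.
Proof.
case/edge_setP=> x [y [/and3P[xP yP _] ->]]; rewrite /fresh_leaves.
case: pickP => // z /andP[zl]; rewrite !inE => /orP[]/eqP zE; move: xP yP.
  by rewrite -zE in_setD zl.
by rewrite -zE !in_setD zl.
Qed.

Hypotheses (tA : subtree A) (A3 : 2 < #|A|).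

Lemma fresh_leaves_leaf z y : z \in leaves A -> induced A z y ->
  fresh_leaves [set z; y] = fresh + enum_rank z.
Proof.
move=> zl izy; have yP := leaf_nbr_peel eF tA A3 zl izy; rewrite /fresh_leaves.
case: pickP => [w /andP[wl]|/(_ z)]; last by rewrite /= zl !inE eqxx.
rewrite !inE => /orP[]/eqP // E; first by rewrite E.
by move: yP; rewrite -E in_setD wl.
Qed.

(** Inner vertices of a path are not leaves, so only its first and last edges can have fresh
    colors. *)
Lemma fresh_leaves_bounded k : 2 < k -> color_bounded (induced (peel A)) (k - 2) f ->
  color_bounded (induced A) k fresh_leaves.
Proof.
move=> k3 fk u p gp; rewrite path_colorsE.
case: p gp => [|x p] gp; first by rewrite /=; lia.
case/lastP: p gp => [|p y] gp; first by rewrite /=; lia.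
have -> : path_edges u (x :: rcons p y) =
    [set u; x] :: rcons (path_edges x p) [set last x p; y].
  by rewrite -cats1 -cat1s !path_edges_cat cats1.
rewrite map_cons map_rcons; apply: leq_trans (size_undup_ends _ _ _) _.
have gxp : spath (induced A) x p.
  by case: (spath_consl gp) => _ + _; rewrite -cats1; apply: spath_catl.
have xP : x \in peel A.
  have /andP[/path_induced sA _] := gp; rewrite in_setD sA ?mem_head // andbT.
  by apply: (spath_interior eF (p := [::]) (q := rcons p y) gp); case: (p).
have lP : last x p \in peel A.
  case/lastP: p gp {gxp} => [|p z] gp //=; rewrite last_rcons.
  have /andP[/path_induced sA _] := gp; rewrite in_setD sA; last first.
    by rewrite inE mem_rcons !inE mem_rcons mem_head !orbT.
  rewrite andbT; apply: (spath_interior eF (v := u) (p := x :: p) (q := [:: y])) => //.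
  by rewrite /= cats1.
have gP := peel_spath eF xP lP gxp.
have -> : map fresh_leaves (path_edges x p) = map f (path_edges x p).
  apply/eq_in_map => E Ep; apply: fresh_leaves_peel.
  by case/andP: gP => /path_edges_sub sub _; apply: sub.
have := fk _ _ gP; rewrite path_colorsE; lia.
Qed.

Lemma fresh_leaves_used :
  colors_used (induced (peel A)) f + #|leaves A| <= colors_used (induced A) fresh_leaves.
Proof.
pose s1 := undup [seq f E | E <- enum (edge_set (induced (peel A)))].
pose s2 := [seq fresh + enum_rank z | z <- enum (leaves A)].
have -> : colors_used (induced (peel A)) f + #|leaves A| = size (s1 ++ s2).
  by rewrite size_cat size_map -cardE.
apply: colors_used_ge => [|c].
  rewrite cat_uniq undup_uniq map_inj_uniq ?enum_uniq ?andbT /=; last first.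
    by move=> x y /addnI/ord_inj/enum_rank_inj.
  apply/hasPn => c /mapP[z _ ->]; rewrite mem_undup; apply/mapP => -[E _ Ef].
  have : f E <= \max_E f E by apply: leq_bigmax.
  by rewrite -Ef /fresh addSn ltnNge leq_addr.
rewrite mem_cat mem_undup => /orP[]/mapP[].
  move=> E; rewrite mem_enum => EP ->; exists E; last exact: fresh_leaves_peel.
  case/edge_setP: EP => x [y [ixy ->]]; apply/edge_setP; exists x, y; split=> //.
  exact: induced_subset (peel_subset e A) ixy.
move=> z; rewrite mem_enum => zl ->; have zA : z \in A by case/setIdP: zl.
have [y izy] := subtree_nbr tA (ltnW A3) zA; exists [set z; y].
  by apply/edge_setP; exists z, y.
exact: fresh_leaves_leaf.
Qed.

End FreshLeaves.

Lemma cc_value_peel A k m : subtree A -> 2 < #|A| -> 2 < k ->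
  cc_value (peel A) (k - 2) m -> cc_value A k (m + #|leaves A|).
Proof.
move=> tA A3 k3 [bnd [f [fk fm]]]; split; first exact: center_bound_peel.
exists (fresh_leaves A f); split; first exact: fresh_leaves_bounded.
by apply: leq_trans (fresh_leaves_used f tA A3); rewrite leq_add2r.
Qed.

(** * Coloring edges by the components left after removing a vertex *)

Section Components.
Variables (A : {set T}) (v : T).

Let h := avoiding (induced A) v.
Let hC : connect_sym h := sym_connect_sym (avoiding_sym (induced_forest eF A) v).

(** An edge at [v] takes the component of its other end. For any other edge both ends lie in the
    same component, so the choice made by [pick] does not matter. *)
Definition component_color (E : {set T}) : nat :=
  if [pick z in E | z != v] is Some z then enum_rank (root h z) else 0.

Lemma component_colorE x y : induced A x y -> x != v ->
  component_color [set x; y] = enum_rank (root h x).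
Proof.
move=> ixy nx; rewrite /component_color; case: pickP => [z|/(_ x)]; last first.
  by rewrite !inE eqxx nx.
rewrite !inE => /andP[/orP[]/eqP-> // ny]; congr (val (enum_rank _)).
by apply/esym/(rootP hC)/connect1; rewrite /h /avoiding /= ixy nx.
Qed.

Lemma component_color_path x p : path (induced A) x p -> v \notin x :: p ->
  {subset map component_color (path_edges x p) <= [:: val (enum_rank (root h x))]}.
Proof.
elim: p x => //= y p IHp x /andP[ixy ip]; rewrite inE negb_or eq_sym => /andP[nx nv] c.
have ny : y != v by apply: contraNneq nv => ->; rewrite mem_head.
have rE : root h x = root h y.
  by apply/(rootP hC)/connect1; rewrite /h /avoiding /= ixy nx.
rewrite inE => /predU1P[->|]; first by rewrite component_colorE // inE.
by move=> /(IHp _ ip nv); rewrite rE.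
Qed.

(** A simple path passes through [v] at most once, so it meets at most two components. *)
Lemma component_color_bounded : color_bounded (induced A) 2 component_color.
Proof.
move=> u p gp; rewrite path_colorsE; have /andP[ip up] := gp.
have iS := proj1 (proj1 (induced_forest eF A)).
have from_v q : spath (induced A) v q ->
    exists c, {subset map component_color (path_edges v q) <= [:: c]}.
  case: q => [|y q] /=; first by exists 0.
  case/spath_consl=> ivy /andP[iq _] nv; exists (enum_rank (root h y) : nat) => c.
  rewrite inE => /predU1P[->|]; last exact: component_color_path.
  rewrite setUC component_colorE ?inE //; first by rewrite iS.
  by apply: contraNneq nv => ->; rewrite mem_head.
case: (boolP (v \in u :: p)) => [vp|nv]; last first.
  by apply: leq_trans (size_undup_sub (component_color_path ip nv)) _.
case/splitPl: vp gp ip up => p1 p2 Ev gp ip up.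
have [c2 sub2] : exists c, {subset map component_color (path_edges v p2) <= [:: c]}.
  by apply: from_v; rewrite -Ev; apply: spath_catr gp.
have [c1 sub1] : exists c, {subset map component_color (path_edges u p1) <= [:: c]}.
  have := spath_catl gp; case/lastP: p1 Ev {gp ip up sub2} => [|p1 w]; first by exists 0.
  rewrite last_rcons => ->; rewrite /spath rcons_path -rcons_cons rcons_uniq.
  case/andP=> /andP[ip iv] /andP[nv _]; exists (enum_rank (root h u) : nat) => c.
  have nl : last u p1 != v by apply: contraNneq nv => <-; rewrite mem_last.
  rewrite -cats1 path_edges_cat map_cat mem_cat => /orP[|].
    exact: component_color_path.
  rewrite /= inE => /eqP->; rewrite component_colorE // inE; apply/eqP.
  congr (val (enum_rank _)); apply/esym/(rootP hC).
  exact: avoiding_connect ip nv (mem_last _ _).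
rewrite path_edges_cat Ev map_cat.
apply: (@size_undup_sub _ _ [:: c1; c2]) => c; rewrite mem_cat => /orP[/sub1|/sub2].
  by rewrite !inE => ->.
by rewrite !inE => ->; rewrite orbT.
Qed.

Lemma component_color_used : v \in A ->
  #|nbrs A v| <= colors_used (induced A) component_color.
Proof.
move=> vA; rewrite cardE -(size_map (fun w => enum_rank (root h w) : nat)).
have iE w : w \in nbrs A v -> induced A v w.
  by rewrite inE => /andP[wA evw]; apply/and3P.
have iS := proj1 (proj1 (induced_forest eF A)).
apply: colors_used_ge => [|c /mapP[w]].
  rewrite map_inj_in_uniq ?enum_uniq // => x y; rewrite !mem_enum => xN yN.
  move=> /ord_inj/enum_rank_inj/(rootP hC); apply: (forest_branch (induced_forest eF A)); exact: iE.
rewrite mem_enum => /iE ivw ->; exists [set w; v].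
  by apply/edge_setP; exists w, v; rewrite iS.
rewrite component_colorE 1?iS //; apply: contraTneq ivw => ->.
by rewrite (proj2 (proj1 (induced_forest eF A))).
Qed.

End Components.

Lemma colorable_maxdeg A k : 0 < #|A| -> 1 < k -> colorable A k (maxdeg A).
Proof.
move=> A0 k2; have [v vA ->] : {v | v \in A & maxdeg A = #|nbrs A v|}.
  exact: eq_bigmax_cond.
exists (component_color A v); split; last exact: component_color_used.
by move=> u p /(component_color_bounded v)/leq_trans; apply.
Qed.

Lemma maxdeg_gt0 A : (0 < maxdeg A) = (edge_set (induced A) != set0).
Proof.
apply/idP/idP => [|/set0Pn[E /edge_setP[x [y [/and3P[xA yA exy] _]]]]].
  rewrite lt0n; apply: contraNneq => noE; rewrite -leqn0; apply/bigmax_leqP => x xA.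
  rewrite leqn0 cards_eq0; apply/set0Pn => -[y]; rewrite inE => /andP[yA exy].
  have : [set x; y] \in edge_set (induced A).
    by apply/edge_setP; exists x, y; split=> //; apply/and3P.
  by rewrite noE inE.
apply: (@leq_trans #|nbrs A x|); last exact: leq_bigmax_cond.
by apply/card_gt0P; exists y; rewrite inE yA.
Qed.

Lemma colorable_minn A k : 0 < k -> colorable A k (minn 1 (maxdeg A)).
Proof.
move=> k0; exists (fun _ => 0); split=> [u p gp|].
  apply: leq_trans k0; rewrite path_colorsE.
  by apply: (@size_undup_sub _ _ [:: 0]) => c /mapP[E _ ->]; rewrite inE.
case: (posnP (maxdeg A)) => [->//|]; rewrite maxdeg_gt0 => /set0Pn[E EA].
apply: leq_trans (geq_minl _ _) _; apply: (@colors_used_ge _ _ [:: 0]) => // c.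
by rewrite inE => /eqP->; exists E.
Qed.

(** For [k <= 2] the first clause of [center] forbids marks beyond a first edge, so all marks are
    edges at [v]. *)
Lemma center_bound_maxdeg A k : subtree A -> k <= 2 -> center_bound e A k (maxdeg A).
Proof.
move=> tA k2 S v vA SA cS; apply: (@leq_trans #|nbrs A v|); last exact: leq_bigmax_cond.
apply: leq_trans (leq_imset_card (fun w => [set v; w]) _).
apply: subset_leq_card; apply/subsetP => E ES.
have [p [z [gp EE]]] := subtree_edge_end eF tA vA (subsetP SA E ES).
case: p gp EE => [|x p] gp EE.
  apply/imsetP; exists z => //; case/spath_consl: gp => /and3P[_ zA evz] _ _.
  by rewrite inE zA.
have := cS.1 x (rcons p z) gp; rewrite -cats1 marks_cat /marks /= -EE ES; lia.
Qed.

(** All marks are edges at [v], and the second clause of [center] excludes two of them. *)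
Lemma center_bound_one A : subtree A -> center_bound e A 1 1.
Proof.
move=> tA S v vA SA cS; rewrite leqNgt; apply/negP => S2.
have star E : E \in S -> exists2 z, spath (induced A) v [:: z] & E = [set v; z].
  move=> ES; have [p [z [gp EE]]] := subtree_edge_end eF tA vA (subsetP SA E ES).
  case: p gp EE => [|x p] gp EE; first by exists z.
  have := cS.1 x (rcons p z) gp; rewrite -cats1 marks_cat /marks /= -EE ES; lia.
have /card_gt1P[E [F [/[dup] ES /star[x gx Ex] /[dup] FS /star[y gy Fy] nEF]]] := S2.
have nxy : x != y by apply: contraNneq nEF => xy; rewrite Ex Fy xy.
by have := cS.2 _ _ _ _ nxy gx gy; rewrite /marks /= -Ex -Fy ES FS.
Qed.

Lemma cc_value_two A : subtree A -> cc_value A 2 (maxdeg A).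
Proof.
move=> tA; split; first exact: center_bound_maxdeg.
by apply: colorable_maxdeg => //; case: tA.
Qed.

Lemma cc_value_one A : subtree A -> cc_value A 1 (minn 1 (maxdeg A)).
Proof.
move=> tA; split; last exact: colorable_minn.
move=> S v vA SA cS; rewrite leq_min (center_bound_one tA vA SA cS).
exact: (center_bound_maxdeg tA _ vA SA cS).
Qed.

(** With at most one edge, every marked set meets the clauses of [center] for 2. This covers trees
    that are used up before [k] is. *)
Lemma cc_value_small A k m : #|A| <= 2 -> 1 < k -> cc_value A 2 m -> cc_value A k m.
Proof.
move=> A2 k2 [bnd [f [f2 fm]]]; split; last first.
  by exists f; split=> // u p /f2/leq_trans; apply.
move=> S v vA SA _; apply: (bnd S v) => //.
have short x p : spath (induced A) v (x :: p) -> p = [::] /\ A \subset [set v; x].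
  case/andP=> ip up; have sA : {subset v :: x :: p <= A}.
    by move=> y; rewrite inE => /predU1P[->//|/(path_induced ip)].
  have := uniq_leq_size up (s2 := enum A).
  rewrite -cardE => H; have : size [:: v, x & p] <= #|A|.
    by apply: H => y /sA; rewrite mem_enum.
  case: p ip up sA H => [|y p] ip up sA _ /=; last by move=> /leq_trans/(_ A2).
  move=> _; split=> //; have /eqP <- : [set v; x] == A; last exact: subxx.
  rewrite eqEcard cards2; move: up; rewrite /= inE andbT => ->; rewrite A2 andbT.
  by apply/subsetP => y; rewrite !inE => /orP[]/eqP->; apply: sA; rewrite !inE eqxx ?orbT.
split=> [x p /short[-> _]|x p y q nxy /short[_ sub] gq]; first by [].
have yA : y \in A by case/andP: gq => /path_induced sA _; apply: sA; rewrite mem_head.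
have := subsetP sub y yA; rewrite !inE eq_sym [y == x]eq_sym (negbTE nxy) orbF => /eqP vy.
by case/spath_consl: gq => _ _; rewrite vy mem_head.
Qed.

Lemma cc_value_is_cc k m : is_tree e -> 0 < k -> cc_value setT k m -> is_cc e k m.
Proof.
move=> [T0 _ conn _] k0 [bnd [f [fk fm]]].
have E2 : induced setT =2 e by move=> x y; apply/and3P/idP => [[]//|exy]; rewrite !inE.
have Ee : edge_set (induced setT) = edge_set e.
  by apply/setP => E; apply/edge_setP/edge_setP => -[x [y [ixy ->]]]; exists x, y; rewrite E2 in ixy *.
have Ec f' : colors_used (induced setT) f' = colors_used e f'.
  by rewrite /colors_used Ee.
have Ep u p : spath (induced setT) u p = spath e u p by rewrite /spath (eq_path E2).
have up f' : color_connection e k f' -> colors_used e f' <= m.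
  move=> f'k; have bk : color_bounded e k f'.
    move=> u p /andP[ep uup]; have [[q /and3P[eq /eqP lq uq] qE] _] := color_distP f' (conn u (last u p)).
    have <- : q = p by apply: (spath_unique eF (u := u)); rewrite /spath ?eq ?ep.
    rewrite qE; apply: leq_trans f'k; apply: leq_trans (leq_bigmax u).
    exact: (leq_bigmax (F := color_dist e f' u) (last u p)).
  have [S [v [SE cS ctr]]] := exists_center eF T0 k0 bk.
  rewrite -cS; apply: (bnd S v); rewrite ?inE ?Ee //.
  case: ctr => c1 c2; split=> [x p|x p y q nxy]; rewrite !Ep; [exact: c1|exact: c2].
have fk' : color_connection e k f.
  apply/bigmax_leqP => u _; apply/bigmax_leqP => v _.
  have [[q /and3P[eq _ uq] <-] _] := color_distP f (conn u v).
  by apply: fk; rewrite Ep /spath eq.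
split=> //; exists f => //; apply/eqP; rewrite eqn_leq up //.
by rewrite -Ec.
Qed.

End Values.

(** * Counting edges *)

Section Counting.
Variables (T : finType) (e : rel T).
Hypothesis eF : forest e.
Implicit Types (A B : {set T}) (u v w x y z : T).

Let eS : symmetric e := proj1 (proj1 eF).
Let eI : irreflexive e := proj2 (proj1 eF).

(** With [v] as root, [phi] sends every other vertex to the edge towards its parent. The result
    fixes the length of the input, and with it the position of all data in memory. *)
Lemma subtree_card_edges A : subtree e A -> #|edge_set (induced e A)| = #|A|.-1.
Proof.
move=> tA; have iF := induced_forest eF A; have [/card_gt0P[v vA] _] := tA.
pose phi z := last set0 (path_edges v (branch_path e A v z)).
have phiE z p : spath (induced e A) v (rcons p z) -> phi z = [set last v p; z].
  move=> gp; rewrite /phi -{1}(last_rcons v p z) branch_pathE //.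
  by rewrite -cats1 path_edges_cat last_cat.
have up z : z \in A :\ v -> exists p, spath (induced e A) v (rcons p z).
  rewrite in_setD1 => /andP[nz zA]; have [p gp zE] := subtree_spath tA vA zA.
  case/lastP: p gp zE => [|p y] gp; first by move=> zE; rewrite zE eqxx in nz.
  by rewrite last_rcons => ->; exists p.
have -> : edge_set (induced e A) = phi @: (A :\ v).
  apply/setP => E; apply/idP/imsetP => [EA|[z /up[p gp] ->]].
    have [p [z [gp EE]]] := subtree_edge_end eF tA vA EA; exists z; last first.
      by rewrite (phiE _ _ gp).
    case/andP: gp => /path_induced sA; rewrite -rcons_cons rcons_uniq inE negb_or.
    by case/andP=> /andP[nz _] _; rewrite in_setD1 nz sA // mem_rcons mem_head.
  rewrite (phiE _ _ gp); apply/edge_setP; exists (last v p), z; split=> //.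
  by case/andP: gp; rewrite rcons_path => /andP[].
rewrite card_in_imset; first by rewrite [in RHS](cardsD1 v) vA.
move=> y z /up[p gp] /up[q gq]; rewrite (phiE _ _ gp) (phiE _ _ gq) => E.
(* Two vertices sharing their parent edge would be parents of each other, and each path from [v]
   would be longer than the other. *)
apply/eqP/idPn => nyz.
have : y \in [set last v q; z] by rewrite -E !inE eqxx orbT.
have : z \in [set last v p; y] by rewrite E !inE eqxx orbT.
rewrite !inE (negbTE nyz) [z == y]eq_sym (negbTE nyz) !orbF => /eqP zE /eqP yE.
have gp' := gp; have gq' := gq; rewrite -!cats1 in gp' gq'.
have : q = rcons p y.
  by apply: (spath_unique iF (spath_catl gq') gp); rewrite last_rcons.
have : p = rcons q z.
  by apply: (spath_unique iF (spath_catl gp') gq); rewrite last_rcons.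
by move=> /(congr1 size) + /(congr1 size); rewrite !size_rcons; lia.
Qed.

Lemma edge_list_edge (es : seq (T * T)) p : edge_list e es -> p \in es -> e p.1 p.2.
Proof.
move=> esE pes; have : [set p.1; p.2] \in edge_set e.
  by rewrite -mem_enum -(perm_mem esE); apply: (map_f (fun p => [set p.1; p.2])).
case/edge_setP=> x [y [exy E]].
have : p.1 \in [set x; y] by rewrite -E !inE eqxx.
have : p.2 \in [set x; y] by rewrite -E !inE eqxx orbT.
have : x \in [set p.1; p.2] by rewrite E !inE eqxx.
have : y \in [set p.1; p.2] by rewrite E !inE eqxx orbT.
rewrite !inE => /orP[]/eqP y1 /orP[]/eqP x1 /orP[]/eqP p2 /orP[]/eqP p1;
  move: exy; rewrite ?y1 ?x1 ?p1 ?p2 ?eI //; by rewrite ?[e y x]eS -?y1 -?x1 ?eI // eS.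
Qed.

(* [F] is [fun=> 1] for degrees and [val] for sums of neighbours. *)
Lemma sum_incident_edges (es : seq (T * T)) (F : T -> nat) v : edge_list e es ->
  \sum_(p <- es) ((if p.1 == v then F p.2 else 0) + (if p.2 == v then F p.1 else 0)) =
  \sum_(w in nbrs e setT v) F w.
Proof.
(* Each term becomes a function of the unordered edge, so that the list can be exchanged for
   [edge_set]. *)
move=> esE; pose h (E : {set T}) := if v \in E then \sum_(w in E | w != v) F w else 0.
have hE x y : e x y -> h [set x; y] =
    (if x == v then F y else 0) + (if y == v then F x else 0).
  move=> exy; have nxy : x != y by apply: contraTneq exy => ->; rewrite eI.
  rewrite /h !inE ![v == _]eq_sym; case: (eqVneq x v) => [xv|nx] /=; last first.
    case: (eqVneq y v) => //= yv; rewrite (big_pred1 x) // => w; rewrite !inE -yv.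
    by case: (eqVneq w x) => [->|] /=; [rewrite nxy | case: (w == y)].
  rewrite -xv [y == x]eq_sym (negbTE nxy) addn0 (big_pred1 y) // => w; rewrite !inE.
  by case: (eqVneq w y) => [->|] /=; [rewrite orbT eq_sym nxy | case: (w == x)].
transitivity (\sum_(p <- es) h [set p.1; p.2]).
  by apply: eq_big_seq => p /(edge_list_edge esE)/hE->.
rewrite -(big_map (fun p : T * T => [set p.1; p.2]) predT h) (perm_big _ esE) /=.
rewrite big_enum /= /h -big_mkcondr /=.
have inj : {in nbrs e setT v &, injective (fun w => [set v; w])}.
  move=> x y; rewrite !inE /= => evx evy /setP/(_ x); rewrite !inE eqxx orbT.
  by case: eqP evx => [->|_ _ /esym/eqP->//]; rewrite eI.
have -> : \sum_(E in edge_set e | v \in E) \sum_(w in E | w != v) F w =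
    \sum_(E in [set [set v; w] | w in nbrs e setT v]) \sum_(w in E | w != v) F w.
  apply: eq_bigl => E; apply/andP/imsetP => [[/edge_setP[x [y [exy ->]]]]|[w]].
    rewrite !inE => /orP[]/eqP->; [exists y|exists x]; rewrite ?inE //= 1?eS //.
    by rewrite setUC.
  rewrite !inE /= => evw ->; rewrite !inE eqxx; split=> //.
  by apply/edge_setP; exists v, w.
rewrite big_imset //=; apply: eq_bigr => w; rewrite !inE /= => evw.
rewrite (big_pred1 w) // => u; rewrite !inE.
case: (eqVneq u w) => [->|_]; last by rewrite orbF andbN.
by rewrite orbT andTb; apply: contraTneq evw => ->; rewrite eI.
Qed.

Lemma nbrs_D1 A x y : nbrs e (A :\ x) y = nbrs e A y :\ x.
Proof. by apply/setP => z; rewrite !inE andbA. Qed.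

End Counting.

(** * While programs for the random access machine *)

Inductive cmd :=
| CSkip
| CAdd of loc & operand & operand
| CSub of loc & operand & operand
| CSeq of cmd & cmd
| CIf of operand & operand & cmd & cmd
| CWhile of operand & operand & cmd.

Fixpoint csize c :=
  match c with
  | CSkip => 0
  | CAdd _ _ _ | CSub _ _ _ => 1
  | CSeq c1 c2 => csize c1 + csize c2
  | CIf _ _ c1 c2 => (csize c1 + csize c2).+2
  | CWhile _ _ c => (csize c).+3
  end.

(** [q] is the position of the code in the whole program, needed because jumps are absolute. Every
    block is left at its end; in a conditional the branch for a failed test comes first and jumps
    over the other. *)
Fixpoint compile q c : program :=
  match c with
  | CSkip => [::]
  | CAdd l x y => [:: IAdd l x y]
  | CSub l x y => [:: ISub l x y]
  | CSeq c1 c2 => compile q c1 ++ compile (q + csize c1) c2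
  | CIf x y c1 c2 =>
      IJle x y (q + csize c2 + 2) :: compile q.+1 c2 ++
      IJmp (q + csize c2 + csize c1 + 2) :: compile (q + csize c2 + 2) c1
  | CWhile x y c =>
      [:: IJle x y q.+2, IJmp (q + csize c + 3) & rcons (compile q.+2 c) (IJmp q)]
  end.

Lemma size_compile q c : size (compile q c) = csize c.
Proof.
elim: c q => //= [c1 IH1 c2 IH2|x y c1 IH1 c2 IH2|x y c IHc] q.
- by rewrite size_cat IH1 IH2.
- by rewrite size_cat /= IH1 IH2 addnS addnC.
- by rewrite size_rcons IHc.
Qed.

Definition located (P : program) q (s : program) := exists s1 s2, P = s1 ++ s ++ s2 /\ size s1 = q.

Lemma located_catl P q s t : located P q (s ++ t) -> located P q s.
Proof. by case=> s1 [s2 [-> <-]]; exists s1, (t ++ s2); rewrite -catA. Qed.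

Lemma located_catr P q s t : located P q (s ++ t) -> located P (q + size s) t.
Proof. by case=> s1 [s2 [-> <-]]; exists (s1 ++ s), s2; rewrite size_cat !catA. Qed.

Lemma located_cons P q i s : located P q (i :: s) -> onth P q = Some i /\ located P q.+1 s.
Proof.
move=> lc; split; last by rewrite -addn1; apply: (@located_catr P q [:: i]).
case: lc => s1 [s2 [-> <-]]; elim: s1 => //=.
Qed.

(** * A program logic with time credits *)

Section Logic.
Variable W : nat.

Definition bounded (m : memory) := forall a, m a <= W.

Definition runs P (j : nat) (s s' : state) :=
  iter j (step P) s = s' /\ forall i, i <= j -> bounded (st_mem (iter i (step P) s)).

Lemma runs0 P s : bounded (st_mem s) -> runs P 0 s s.
Proof. by move=> bs; split=> // -[]. Qed.

Lemma runs_step P s i j s' : onth P (st_pc s) = Some i -> bounded (st_mem s) ->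
  runs P j (exec i s) s' -> runs P j.+1 s s'.
Proof.
move=> Pi bs [Es bd]; have st : step P s = exec i s by rewrite /step Pi.
split=> [|[|l] le]; rewrite ?iterSr ?st //; exact: bd.
Qed.

Lemma runs_trans P j1 j2 s1 s2 s3 :
  runs P j1 s1 s2 -> runs P j2 s2 s3 -> runs P (j1 + j2) s1 s3.
Proof.
move=> [E1 b1] [E2 b2]; split; first by rewrite addnC iterD E1.
move=> i le; case: (leqP i j1) => [/b1//|lt].
have -> : i = (i - j1) + j1 by lia.
by rewrite iterD E1; apply: b2; lia.
Qed.

(* [t] is a supply of time credits, and [Q] receives those left over. *)
Definition wp c (m : memory) (t : nat) (Q : memory -> nat -> Prop) : Prop :=
  bounded m -> forall P q, located P q (compile q c) ->
  exists j t' m', [/\ j + t' <= t, bounded m', Q m' t' &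
                      runs P j (State q m) (State (q + csize c) m')].

Lemma wp_skip m t Q : Q m t -> wp CSkip m t Q.
Proof.
by move=> Qm bm P q _; exists 0, t, m; rewrite addn0; split=> //; apply: runs0.
Qed.

Lemma bounded_upd m a x : bounded m -> x <= W -> bounded (upd m a x).
Proof. by move=> bm le b; rewrite /upd; case: eqP. Qed.

(** The credit has the form of a numeral plus a rest, so a run of assignments consumes the numeral
    by unification alone. *)
Lemma wp_add l x y m c t (Q : memory -> nat -> Prop) :
  operand_val m x + operand_val m y <= W ->
  Q (upd m (loc_addr m l) (operand_val m x + operand_val m y)) (c + t) ->
  wp (CAdd l x y) m (c.+1 + t) Q.
Proof.
move=> le Qm bm P q /located_cons[Pq _]; exists 1, (c + t); eexists; split; [| |exact: Qm|]; rewrite ?addSn //.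
  exact: bounded_upd.
rewrite addn1; apply: (runs_step (i := _) (s := State q m) Pq bm).
apply: runs0; exact: bounded_upd.
Qed.

Lemma wp_sub l x y m c t (Q : memory -> nat -> Prop) :
  operand_val m x - operand_val m y <= W ->
  Q (upd m (loc_addr m l) (operand_val m x - operand_val m y)) (c + t) ->
  wp (CSub l x y) m (c.+1 + t) Q.
Proof.
move=> le Qm bm P q /located_cons[Pq _]; exists 1, (c + t); eexists; split; [| |exact: Qm|]; rewrite ?addSn //.
  exact: bounded_upd.
rewrite addn1; apply: (runs_step (i := _) (s := State q m) Pq bm).
apply: runs0; exact: bounded_upd.
Qed.

Lemma wp_seq c1 c2 m t Q :
  wp c1 m t (fun m1 t1 => wp c2 m1 t1 Q) -> wp (CSeq c1 c2) m t Q.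
Proof.
move=> w1 bm P q /= lc; have [j1 [t1 [m1 [le1 b1 w2 r1]]]] := w1 bm P q (located_catl lc).
have := located_catr lc; rewrite size_compile => /(w2 b1)[j2 [t2 [m2 [le2 b2 Qm r2]]]].
exists (j1 + j2), t2, m2; split=> //; first by lia.
by rewrite addnA; apply: runs_trans r1 r2.
Qed.

(* Keeps the postcondition folded during symbolic execution. *)
Lemma wp_hold c m t Q : wp c m t (fun m1 t1 => wp CSkip m1 t1 Q) -> wp c m t Q.
Proof.
move=> w bm P q lc; have [j1 [t1 [m1 [le1 b1 w1 r1]]]] := w bm P q lc.
have [|j2 [t2 [m2 [le2 b2 Qm r2]]]] := w1 b1 P (q + csize c).
  by case: lc => s1 [s2 [-> <-]]; exists (s1 ++ compile (size s1) c), s2;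
    rewrite size_cat size_compile catA.
exists (j1 + j2), t2, m2; split=> //; first by lia.
by rewrite addn0 in r2; apply: runs_trans r1 r2.
Qed.

(** Two steps are charged, the cost of the slower branch, which needs a jump besides the test. *)
Lemma wp_if x y c1 c2 m c t Q :
  (operand_val m x <= operand_val m y -> wp c1 m (c + t) Q) ->
  (operand_val m y < operand_val m x -> wp c2 m (c + t) Q) ->
  wp (CIf x y c1 c2) m (c.+2 + t) Q.
Proof.
move=> w1 w2 bm P q /= /located_cons[Pq lc].
have lc2 := located_catl lc; have := located_catr lc; rewrite size_compile.
case/located_cons=> Pj lc1.
case: (leqP (operand_val m x) (operand_val m y)) => cmp.
  have E : (q.+1 + csize c2).+1 = q + csize c2 + 2 by lia.
  rewrite E in lc1; have [j [t' [m' [le b Qm r]]]] := w1 cmp bm P _ lc1.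
  exists j.+1, t', m'; split=> //; first by lia.
  apply: (runs_step (s := State q m) Pq bm); rewrite /= cmp.
  have -> : q + (csize c1 + csize c2).+2 = q + csize c2 + 2 + csize c1 by lia.
  exact: r.
have [j [t' [m' [le b Qm r]]]] := w2 cmp bm P q.+1 lc2.
exists j.+2, t', m'; split=> //.
apply: (runs_step (s := State q m) Pq bm); rewrite /= leqNgt cmp /=.
rewrite -[j.+1]addn1; apply: runs_trans r _.
apply: (runs_step (s := State (q.+1 + csize c2) m') Pj b) => /=.
have -> : q + csize c2 + csize c1 + 2 = q + (csize c1 + csize c2).+2 by lia.
exact: runs0.
Qed.

(** The credit is also the variant: every round spends two steps, on the test and a jump, so
    induction on [t] yields termination. *)
Lemma wp_while (I : memory -> nat -> Prop) x y c m t Q :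
  I m t ->
  (forall m1 t1, I m1 t1 -> 1 < t1) ->
  (forall m1 t1, I m1 t1 -> operand_val m1 x <= operand_val m1 y -> wp c m1 t1.-2 I) ->
  (forall m1 t1, I m1 t1 -> operand_val m1 y < operand_val m1 x -> Q m1 t1.-2) ->
  wp (CWhile x y c) m t Q.
Proof.
move=> Im I2 body exit bm P q; rewrite [compile _ _]/= => lc.
have [Pq /located_cons[Pq1]] := located_cons lc.
rewrite -cats1 => lcc; have lc1 := located_catl lcc.
have := located_catr lcc; rewrite size_compile => /located_cons[Pj _].
have [n le_n] := ubnP t; elim: n t m Im bm le_n => // n IHn t m Im bm le_n.
case: (leqP (operand_val m x) (operand_val m y)) => cmp; last first.
  exists 2, t.-2, m; split=> //; [have := I2 _ _ Im; lia | exact: exit |].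
  apply: (runs_step (s := State q m) Pq bm); rewrite /= leqNgt cmp /=.
  apply: (runs_step (s := State q.+1 m) Pq1 bm) => /=.
  by rewrite addnS addn2 !addnS; apply: runs0.
have lt2 := I2 _ _ Im.
have [j [t3 [m1 [le3 b1 I1 r1]]]] := body m t Im cmp bm P q.+2 lc1.
have [|j2 [t4 [m2 [le4 b2 Q2 r2]]]] := IHn t3 m1 I1 b1; first by lia.
exists (j + j2.+1).+1, t4, m2; split=> //; first by lia.
apply: (runs_step (s := State q m) Pq bm); rewrite /= cmp.
apply: runs_trans r1 _.
exact: (runs_step (s := State (q.+2 + csize c) m1) Pj b1).
Qed.

End Logic.

Lemma wp_ram_computes W c input t (Q : nat -> Prop) :
  bounded W (nth 0 input) -> wp W c (nth 0 input) t (fun m _ => Q (m 0)) ->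
  exists2 out, Q out & ram_computes (compile 0 c) input t W out.
Proof.
move=> b0 /(_ b0 (compile 0 c) 0)[].
  by exists [::], [::]; rewrite cats0.
move=> j [t' [m' [le b Qm [Ej bd]]]]; exists (m' 0) => //; exists j; first by lia.
split; rewrite /start ?Ej //; first by rewrite /halted size_compile.
by move=> i a /bd; apply.
Qed.

(** * The program *)

Arguments upd : simpl never.

Lemma upd_same m a x b : b = a -> upd m a x b = x.
Proof. by move=> ->; rewrite /upd eqxx. Qed.

Lemma upd_diff m a x b : b <> a -> upd m a x b = m b.
Proof. by move=> /eqP/negbTE nab; rewrite /upd nab. Qed.

Local Ltac read := repeat first
  [ match goal with |- context [upd ?m ?a ?x ?b] =>
      lazymatch b with context [upd] => fail | _ => idtac end;
      lazymatch a with context [upd] => fail | _ => idtac end;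
      first [ rewrite (@upd_same m a x b); [|reflexivity]
            | rewrite (@upd_diff m a x b); [|discriminate]
            | rewrite (@upd_diff m a x b); [|clear; lia]
            | rewrite (@upd_diff m a x b); [|lia]
            | rewrite (@upd_same m a x b); [|lia] ] end
  | match goal with H : ?m ?a = _ |- context [?m ?a] =>
      match type of m with memory => rewrite H end end ].

Local Ltac simp_mem := rewrite /= ?addn0; read; rewrite ?addn0.

Local Ltac assign :=
  try apply: wp_seq; first [apply: wp_add | apply: wp_sub]; [simp_mem; try lia | simp_mem].

Local Notation "c1 ;; c2" := (CSeq c1 c2) (at level 60, right associativity).
Local Notation "'reg' i" := (Cell (Dir i)) (at level 10).
Local Notation "'deref' i" := (Cell (Ind i)) (at level 10).
Local Notation CMov l x := (CAdd l x (Imm 0)).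

(* Only cells 0 and 1 are free at first: the remaining input is moved from cells
   2..2n to 2n+18..4n+16, so that cells 0..15 can serve as registers. The number n
   itself is lost, and only 2n is available afterwards. *)
Definition prog_move :=
  CAdd (Dir 0) (reg 0) (reg 0) ;;
  CMov (Ind 0) (reg 1) ;;
  CAdd (Dir 1) (reg 0) (reg 0) ;;
  CAdd (Dir 1) (reg 1) (Imm 16) ;;
  CWhile (Imm 2) (reg 0)
    (CMov (Ind 1) (deref 0) ;;
     CSub (Dir 0) (reg 0) (Imm 1) ;;
     CSub (Dir 1) (reg 1) (Imm 1)).

(** The move leaves [2n + 17] in cell 1, whence the 17. The edges occupy cells [2n + 18] to
    [4n + 15], [k] is in [4n + 16], the degrees and the sums take [2n] cells each from [4n + 17] and
    [6n + 17], and the queue begins at [8n + 17]. *)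
Definition prog_setup :=
  CSub (Dir 2) (reg 1) (Imm 17) ;;
  CAdd (Dir 9) (reg 1) (Imm 1) ;;
  CAdd (Dir 8) (reg 1) (reg 2) ;;
  CSub (Dir 8) (reg 8) (Imm 1) ;;
  CMov (Dir 3) (deref 8) ;;
  CAdd (Dir 4) (reg 8) (Imm 1) ;;
  CAdd (Dir 5) (reg 4) (reg 2) ;;
  CAdd (Dir 6) (reg 5) (reg 2) ;;
  CMov (Dir 7) (reg 6) ;;
  CMov (Dir 13) (reg 2) ;;
  CSub (Dir 8) (reg 8) (Imm 1).

(* Register 2 holds 2n, register 3 the current k, registers 4 and 5 the base
   addresses of the degrees and of the sums of neighbours, registers 6 and 7 the
   ends of the queue, and register 13 twice the number of vertices left. *)
Definition prog_edges :=
  CWhile (reg 9) (reg 8)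
    (CMov (Dir 10) (deref 9) ;;
     CAdd (Dir 9) (reg 9) (Imm 1) ;;
     CMov (Dir 11) (deref 9) ;;
     CAdd (Dir 9) (reg 9) (Imm 1) ;;
     CAdd (Dir 12) (reg 4) (reg 10) ;;
     CAdd (Ind 12) (deref 12) (Imm 1) ;;
     CAdd (Dir 12) (reg 4) (reg 11) ;;
     CAdd (Ind 12) (deref 12) (Imm 1) ;;
     CAdd (Dir 12) (reg 5) (reg 10) ;;
     CAdd (Ind 12) (deref 12) (reg 11) ;;
     CAdd (Dir 12) (reg 5) (reg 11) ;;
     CAdd (Ind 12) (deref 12) (reg 10)).

Definition prog_leaves :=
  CMov (Dir 0) (Imm 0) ;;
  CMov (Dir 9) (Imm 0) ;;
  CSub (Dir 8) (reg 2) (Imm 1) ;;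
  CWhile (reg 9) (reg 8)
    (CAdd (Dir 12) (reg 4) (reg 9) ;;
     CMov (Dir 10) (deref 12) ;;
     CIf (Imm 1) (reg 10)
       (CIf (reg 10) (Imm 1)
          (CMov (Ind 7) (reg 9) ;; CAdd (Dir 7) (reg 7) (Imm 1))
          CSkip)
       CSkip ;;
     CAdd (Dir 9) (reg 9) (Imm 1)).

(** Stated for arbitrary lists of pairs, so that the loop reading the edges can apply it to the
    prefix read so far. *)
Definition incident (F : nat -> nat) (ps : seq (nat * nat)) v :=
  \sum_(p <- ps) ((if p.1 == v then F p.2 else 0) + (if p.2 == v then F p.1 else 0)).

Lemma incident_rcons F ps p v : incident F (rcons ps p) v =
  incident F ps v + ((if p.1 == v then F p.2 else 0) + (if p.2 == v then F p.1 else 0)).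
Proof. by rewrite /incident -cats1 big_cat /= big_seq1. Qed.

Lemma incident_le F ps v n c : (forall a, a < n -> F a <= c) ->
  all (fun p => (p.1 < n) && (p.2 < n)) ps -> incident F ps v <= 2 * c * size ps.
Proof.
move=> Fc; elim/last_ind: ps => [|ps p IHps]; first by rewrite /incident big_nil.
rewrite all_rcons => /andP[/andP[p1 p2] /IHps]; rewrite incident_rcons size_rcons.
have := Fc _ p1; have := Fc _ p2; case: ifP => _; case: ifP => _; lia.
Qed.

(** * Moving the input and accumulating degrees and sums of neighbours *)

Section Input_phase.
Variables (n W : nat).
Hypotheses (n_gt0 : 0 < n) (W_large : 12 * n + 40 + 2 * n * n <= W).

Lemma wp_move (m : memory) t (Q : memory -> nat -> Prop) :
  m 0 = n -> m 1 <= W -> (forall a, 2 <= a < 2 * n -> m a <= W) ->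
  (forall a, 2 * n <= a -> m a = 0) -> 10 * n + 10 <= t ->
  (forall (m' : memory) t', t <= t' + (10 * n + 10) -> m' 1 = 2 * n + 17 ->
     (forall a, 2 <= a < 2 * n -> m' (2 * n + 16 + a) = m a) ->
     m' (4 * n + 16) = m 1 ->
     (forall a, 4 * n + 16 < a -> m' a = 0) -> Q m' t') ->
  wp W prog_move m t Q.
Proof.
move=> m0 m1 mW mZ lt_t Qpost; rewrite /prog_move.
(* The block to be moved: the edges, followed by [k], which the second assignment stores in cell
   [2n]. *)
pose g a := if a < 2 * n then m a else m 1.
have gW a : 2 <= a -> g a <= W.
  by move=> a2; rewrite /g; case: ifP => // lt; apply: mW; rewrite a2.
have Et : t = 4 + (t - 4) by lia.
rewrite {1}Et; do 4 assign.
apply: (wp_while (I := fun m' t' => exists2 j, 1 <= j <= 2 * n /\ t <= t' + 4 + 5 * (2 * n - j) &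
   [/\ m' 0 = j, m' 1 = 2 * n + 16 + j, forall a, 2 <= a <= j -> m' a = g a,
    forall a, j < a <= 2 * n -> m' (2 * n + 16 + a) = g a &
    forall a, 4 * n + 16 < a -> m' a = 0])).
- exists (2 * n); first by lia.
  split.
  + by read; lia.
  + by read; lia.
  + move=> a la; rewrite /g; case: ltnP => lt; read => //.
  + lia.
  + by move=> a la; read; apply: mZ; lia.
- by move=> m1' t1 [j]; lia.
- move=> m' t1 [j [lj lt] [r0 r1 low high zero]] /=; rewrite r0 => lt2.
  have lowj : m' j = g j by apply: low; lia.
  have -> : t1.-2 = 3 + (t1 - 5) by lia.
  apply: wp_hold; assign; first by apply: gW.
  do 2 assign; apply: wp_skip.
  exists j.-1; first by lia.
  split.
  + by read; lia.
  + by read; lia.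
  + by move=> a la; read; apply: low; lia.
  + move=> a la; case: (eqVneq a j) => [->|ne]; read => //; apply: high; lia.
  + by move=> a la; read; apply: zero.
- move=> m' t1 [j [lj lt] [r0 r1 low high zero]] /=; rewrite r0 => lt2.
  have j1 : j = 1 by lia.
  apply: Qpost; rewrite ?r1 //; try lia.
  + by move=> a la; rewrite high /g ?j1; [case: ltnP => //; lia | lia].
  + have -> : 4 * n + 16 = 2 * n + 16 + 2 * n by lia.
    by rewrite high /g ?ltnn // j1; lia.
Qed.

Definition regs (m : memory) :=
  [/\ m 2 = 2 * n, m 4 = 4 * n + 17 & m 5 = 6 * n + 17].

Lemma wp_setup (m : memory) t (Q : memory -> nat -> Prop) :
  m 1 = 2 * n + 17 -> m (4 * n + 16) <= W -> 11 <= t ->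
  (forall m' : memory, regs m' -> m' 3 = m (4 * n + 16) ->
     m' 6 = 8 * n + 17 -> m' 7 = 8 * n + 17 -> m' 13 = 2 * n ->
     m' 9 = 2 * n + 18 -> m' 8 = 4 * n + 15 ->
     (forall a, 2 * n + 18 <= a -> m' a = m a) -> Q m' (t - 11)) ->
  wp W prog_setup m t Q.
Proof.
move=> m1 kW t11 Qpost; rewrite /prog_setup.
have -> : t = 11 + (t - 11) by lia.
do 4 assign.
have E : 2 * n + 17 + (2 * n + 17 - 17) - 1 = 4 * n + 16 by lia.
assign; first by rewrite E.
do 6 assign.
rewrite [_ + (t - 11)]/= add0n.
by apply: Qpost; first split; try move=> a la; read; rewrite ?E //; lia.
Qed.

Section Edges.
Variable ps : seq (nat * nat).
Hypotheses (ps_size : size ps = n.-1)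
  (ps_lt : all (fun p => (p.1 < n) && (p.2 < n)) ps)
  (ps_neq : all (fun p => p.1 != p.2) ps).

Lemma wp_edges (m : memory) t (Q : memory -> nat -> Prop) :
  regs m -> m 9 = 2 * n + 18 -> m 8 = 4 * n + 15 ->
  (forall i, i < size ps -> m (2 * n + 18 + 2 * i) = (nth (0, 0) ps i).1) ->
  (forall i, i < size ps -> m (2 * n + 19 + 2 * i) = (nth (0, 0) ps i).2) ->
  (forall a, 4 * n + 16 < a -> m a = 0) -> 16 * n <= t ->
  (forall (m' : memory) t', t <= t' + 16 * n -> regs m' ->
     m' 3 = m 3 -> m' 6 = m 6 -> m' 7 = m 7 -> m' 13 = m 13 ->
     (forall v, v < 2 * n -> m' (4 * n + 17 + v) = incident (fun=> 1) ps v) ->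
     (forall v, v < 2 * n -> m' (6 * n + 17 + v) = incident id ps v) -> Q m' t') ->
  wp W prog_edges m t Q.
Proof.
move=> rm m9 m8 e1 e2 mZ lt_t Qpost; rewrite /prog_edges.
(* Twelve assignments and two steps of the loop make 14 per edge. *)
apply: (wp_while (I := fun m' t' => exists2 i, i <= size ps /\ t <= t' + 14 * i &
   [/\ regs m', m' 9 = 2 * n + 18 + 2 * i /\ m' 8 = m 8,
       [/\ m' 3 = m 3, m' 6 = m 6, m' 7 = m 7 & m' 13 = m 13],
       forall a, 2 * n + 18 <= a <= 4 * n + 16 -> m' a = m a &
       forall v, v < 2 * n -> m' (4 * n + 17 + v) = incident (fun=> 1) (take i ps) v /\
         m' (6 * n + 17 + v) = incident id (take i ps) v])).
- exists 0; first by lia.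
  split=> //; first by rewrite m9 m8; lia.
  by move=> v lv; rewrite take0 /incident !big_nil !mZ //; lia.
- move=> m' t' [i [li lt] _]; lia.
- move=> m' t' [i [li lt] [[r2 r4 r5] [r9 r8] [r3 r6 r7 r13] old new]] /=.
  rewrite r9 r8 m8 => lti; have {}li : i < size ps by lia.
  case Ep: (nth (0, 0) ps i) => [x y].
  have pin : (x, y) \in ps by rewrite -Ep mem_nth.
  have /andP[/= xn yn] := allP ps_lt _ pin; have /= /eqP nxy := allP ps_neq _ pin.
  have mx : m' (2 * n + 18 + 2 * i) = x by rewrite old ?e1 ?Ep //; lia.
  have my : m' (2 * n + 18 + 2 * i + 1) = y.
    by rewrite old; [rewrite -[y]/((x, y).2) -Ep -e2 //; congr (m _) |]; lia.
  have all_lt : all (fun p => (p.1 < n) && (p.2 < n)) (take i ps).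
    by apply/allP => p /mem_take; apply: (allP ps_lt).
  have sz : size (take i ps) <= n by rewrite size_take; case: ifP; lia.
  have b1 v : incident (fun=> 1) (take i ps) v <= 2 * n.
    have le1 : forall a, a < n -> 1 <= 1 by [].
    by have := incident_le v le1 all_lt; lia.
  have b2 v : incident id (take i ps) v <= 2 * n * n.-1.
    have le2 a : a < n -> id a <= n by move=> /ltnW.
    apply: leq_trans (incident_le v le2 all_lt) _.
    by rewrite leq_mul2l; apply/orP; right; rewrite size_take; case: ifP; lia.
  have [dx sx] := new x (ltac:(lia)); have [dy sy] := new y (ltac:(lia)).
  have b2' v : incident id (take i ps) v + n <= W by have := b2 v; nia.
  have := b1 x; have := b1 y; have := b2' x; have := b2' y => b2y b2x b1y b1x.
  have -> : t'.-2 = 12 + (t' - 14) by lia.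
  apply: wp_hold; do 12 assign; apply: wp_skip.
  exists i.+1; first by lia.
  split.
  + by split; read.
  + by read; lia.
  + by split; read.
  + by move=> a la; read; apply: old; lia.
  move=> v lv; have [dv sv] := new v lv; rewrite (take_nth (0, 0)) // Ep.
  rewrite !incident_rcons /=.
  case: (eqVneq x v) => [xv|nx]; first by subst v; rewrite (introF eqP (nesym nxy)); read; lia.
  case: (eqVneq y v) => [yv|ny]; first by subst v; read; lia.
  by read; lia.
- move=> m' t' [i [li lt] [rm' [r9 r8] [r3 r6 r7 r13] old new]] /=.
  rewrite r9 r8 m8 => lti; have E : i = size ps by lia.
  rewrite E take_size in new.
  by apply: Qpost => //; [lia | move=> v /new[] | move=> v /new[]].
Qed.

End Edges.

End Input_phase.

Local Ltac branch := try apply: wp_seq; apply: wp_if; simp_mem.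

Definition prog_max :=
  CMov (Dir 9) (Imm 0) ;;
  CMov (Dir 14) (Imm 0) ;;
  CSub (Dir 8) (reg 2) (Imm 1) ;;
  CWhile (reg 9) (reg 8)
    (CAdd (Dir 12) (reg 4) (reg 9) ;;
     CMov (Dir 10) (deref 12) ;;
     CIf (reg 14) (reg 10) (CMov (Dir 14) (reg 10)) CSkip ;;
     CAdd (Dir 9) (reg 9) (Imm 1)).

(** * Scans of the degree array *)

Section Scans.
Variables (n W : nat).
Hypotheses (n_gt0 : 0 < n) (W_large : 12 * n + 40 + 2 * n * n <= W).

Lemma wp_leaves (m : memory) t (Q : memory -> nat -> Prop) :
  regs n m -> m 7 = 8 * n + 17 -> 22 * n + 10 <= t ->
  (forall (m' : memory) t', t <= t' + 22 * n + 10 -> regs n m' -> m' 0 = 0 ->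
     m' 3 = m 3 -> m' 6 = m 6 -> m' 13 = m 13 ->
     (forall a, 4 * n + 17 <= a < 8 * n + 17 -> m' a = m a) ->
     let qs := [seq v <- iota 0 (2 * n) | m (4 * n + 17 + v) == 1] in
     m' 7 = 8 * n + 17 + size qs ->
     (forall j, j < size qs -> m' (8 * n + 17 + j) = nth 0 qs j) -> Q m' t') ->
  wp W prog_leaves m t Q.
Proof.
move=> [r2 r4 r5] r7 lt_t Qpost; rewrite /prog_leaves.
have Et : t = 3 + (t - 3) by lia.
rewrite {1}Et; do 3 assign.
pose qs i := [seq v <- iota 0 i | m (4 * n + 17 + v) == 1].
have qsS i : qs i.+1 = qs i ++ if m (4 * n + 17 + i) == 1 then [:: i] else [::].
  by rewrite /qs -[i.+1]addn1 iotaD filter_cat /= add0n; case: eqP.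
have qs_size i : size (qs i) <= i.
  by rewrite -[leqRHS](size_iota 0) size_filter count_size.
apply: (wp_while (I := fun m' t' => exists2 i, i <= 2 * n /\ t <= t' + 3 + 11 * i &
   [/\ regs n m', [/\ m' 9 = i, m' 8 = (2 * n).-1 & m' 0 = 0],
       [/\ m' 3 = m 3, m' 6 = m 6, m' 13 = m 13 & m' 7 = 8 * n + 17 + size (qs i)],
       forall a, 4 * n + 17 <= a < 8 * n + 17 -> m' a = m a &
       forall j, j < size (qs i) -> m' (8 * n + 17 + j) = nth 0 (qs i) j])).
- exists 0; first by lia.
  have qs0 : size (qs 0) = 0 by [].
  split=> //; try by split; read; lia.
  by move=> a la; read.
- move=> m' t' [i [li lt] _]; lia.
- move=> m' t' [i [li lt] [[s2 s4 s5] [s9 s8 s0] [s3 s6 s13 s7] old new]] /=.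
  rewrite s9 s8 => lti; have {}li : i < 2 * n by lia.
  have di : m' (4 * n + 17 + i) = m (4 * n + 17 + i) by apply: old; lia.
  have mW : bounded W m' -> m (4 * n + 17 + i) <= W by move=> /(_ (4 * n + 17 + i)); rewrite di.
  have sz := qs_size i.
  have -> : t'.-2 = 9 + (t' - 11) by lia.
  (* [wp] assumes that its memory is bounded, and this bounds the degree about to be copied. *)
  move=> bW; have {}mW := mW bW; move: bW; apply: wp_hold.
  do 2 assign.
  branch; [move=> c1; branch; [move=> c2; do 3 assign | move=> c2] | move=> c1].
  + apply: wp_skip; have Ei : qs i.+1 = rcons (qs i) i.
      by rewrite qsS -cats1 (_ : m _ == 1) //; lia.
    exists i.+1; first by lia.
    rewrite Ei size_rcons; split; try by split; read; lia.
      by move=> a la; read; apply: old.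
    move=> j lj; rewrite nth_rcons; case: ltngtP => [ltj|ltj|Ej]; [|lia|].
      by read; apply: new.
    by read.
  + apply: wp_skip; assign; apply: wp_skip.
    have Ei : qs i.+1 = qs i by rewrite qsS (_ : m _ == 1 = false) ?cats0 //; lia.
    exists i.+1; first by lia.
    rewrite Ei; split; try by split; read; lia.
      by move=> a la; read; apply: old.
    by move=> j lj; read; apply: new.
  + apply: wp_skip; assign; apply: wp_skip.
    have Ei : qs i.+1 = qs i by rewrite qsS (_ : m _ == 1 = false) ?cats0 //; lia.
    exists i.+1; first by lia.
    rewrite Ei; split; try by split; read; lia.
      by move=> a la; read; apply: old.
    by move=> j lj; read; apply: new.
- move=> m' t' [i [li lt] [rm' [s9 s8 s0] [s3 s6 s13 s7] old new]] /=.
  rewrite s9 s8 => lti; have Ei : i = 2 * n by lia.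
  by rewrite Ei in s7 new; apply: Qpost => //; lia.
Qed.

Lemma wp_max (m : memory) t (Q : memory -> nat -> Prop) :
  regs n m -> 18 * n + 10 <= t ->
  (forall (m' : memory) t', t <= t' + 18 * n + 10 -> m' 0 = m 0 -> m' 3 = m 3 ->
     (forall v, v < 2 * n -> m (4 * n + 17 + v) <= m' 14) ->
     (m' 14 = 0 \/ exists2 v, v < 2 * n & m' 14 = m (4 * n + 17 + v)) -> Q m' t') ->
  wp W prog_max m t Q.
Proof.
move=> [r2 r4 r5] lt_t Qpost; rewrite /prog_max.
have Et : t = 3 + (t - 3) by lia.
rewrite {1}Et; do 3 assign.
apply: (wp_while (I := fun m' t' => exists2 i, i <= 2 * n /\ t <= t' + 3 + 9 * i &
   [/\ regs n m', [/\ m' 9 = i, m' 8 = (2 * n).-1, m' 0 = m 0 & m' 3 = m 3],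
       forall a, 4 * n + 17 <= a < 6 * n + 17 -> m' a = m a,
       forall v, v < i -> m (4 * n + 17 + v) <= m' 14 &
       m' 14 = 0 \/ exists2 v, v < i & m' 14 = m (4 * n + 17 + v)])).
- exists 0; first by lia.
  split=> //; try by split; read; lia.
  by move=> a la; read.
  by left; read.
- move=> m' t' [i [li lt] _]; lia.
- move=> m' t' [i [li lt] [[s2 s4 s5] [s9 s8 s0 s3] old ub att]] /=.
  rewrite s9 s8 => lti; have {}li : i < 2 * n by lia.
  have di : m' (4 * n + 17 + i) = m (4 * n + 17 + i) by apply: old; lia.
  have mW : bounded W m' -> m (4 * n + 17 + i) <= W by move=> /(_ (4 * n + 17 + i)); rewrite di.
  have -> : t'.-2 = 7 + (t' - 9) by lia.
  move=> bW; have {}mW := mW bW; move: bW; apply: wp_hold.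
  do 2 assign.
  branch; move=> c1; [assign | apply: wp_skip]; assign; apply: wp_skip.
  + exists i.+1; first by lia.
    split; try by split; read; lia.
    * by move=> a la; read; apply: old.
    * move=> v lv; read; case: (eqVneq v i) => [->//|ne].
      by apply: leq_trans c1; apply: ub; lia.
    * by right; exists i; read.
  + exists i.+1; first by lia.
    split; try by split; read; lia.
    * by move=> a la; read; apply: old.
    * move=> v lv; read; case: (eqVneq v i) => [->|ne]; first exact: ltnW.
      by apply: ub; lia.
    * read; case: att => [->|[v lv ->]]; [by left | right; exists v => //; lia].
- move=> m' t' [i [li lt] [rm' [s9 s8 s0 s3] old ub att]] /=.
  rewrite s9 s8 => lti; have Ei : i = 2 * n by lia.
  by rewrite Ei in ub att; apply: Qpost => //; lia.
Qed.

End Scans.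

(** The neighbour is queued when its degree becomes exactly 1, hence once only, even if the degree
    drops to 0 later in the round. Cell 0 counts the removed leaves and so builds up the answer. *)
Definition prog_remove :=
  CMov (Dir 9) (deref 6) ;;
  CAdd (Dir 6) (reg 6) (Imm 1) ;;
  CAdd (Dir 12) (reg 4) (reg 9) ;;
  CMov (Ind 12) (Imm 0) ;;
  CAdd (Dir 12) (reg 5) (reg 9) ;;
  CMov (Dir 10) (deref 12) ;;
  CAdd (Dir 12) (reg 5) (reg 10) ;;
  CSub (Ind 12) (deref 12) (reg 9) ;;
  CAdd (Dir 12) (reg 4) (reg 10) ;;
  CSub (Dir 14) (deref 12) (Imm 1) ;;
  CMov (Ind 12) (reg 14) ;;
  CSub (Dir 13) (reg 13) (Imm 2) ;;
  CAdd (Dir 0) (reg 0) (Imm 1) ;;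
  CIf (Imm 1) (reg 14)
    (CIf (reg 14) (Imm 1)
       (CMov (Ind 7) (reg 10) ;; CAdd (Dir 7) (reg 7) (Imm 1))
       CSkip)
    CSkip.

(** Register 8 freezes the end of the queue, so vertices that become leaves during a round wait for
    the next one. *)
Definition prog_round :=
  CSub (Dir 8) (reg 7) (Imm 1) ;;
  CWhile (reg 6) (reg 8) prog_remove.

Lemma wp_remove n W (m : memory) t (Q : memory -> nat -> Prop) l u q :
  12 * n + 40 <= W -> regs n m -> m 0 <= n -> 8 * n + 17 <= m 6 -> m 6 < m 7 ->
  m 7 <= 12 * n + 30 ->
  m (m 6) = l -> m (6 * n + 17 + l) = u -> m 7 = q -> l < n -> u < n -> u <> l ->
  (forall (m' : memory) t', t <= t' -> regs n m' -> m' 0 = m 0 + 1 -> m' 3 = m 3 -> m' 6 = m 6 + 1 ->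
     m' 8 = m 8 -> m' 13 = m 13 - 2 ->
     (m' 7 = if m (4 * n + 17 + u) - 1 == 1 then q + 1 else q) ->
     (m (4 * n + 17 + u) - 1 = 1 -> m' q = u) ->
     m' (4 * n + 17 + l) = 0 ->
     m' (4 * n + 17 + u) = m (4 * n + 17 + u) - 1 ->
     (forall v, v < 2 * n -> v <> l -> v <> u -> m' (4 * n + 17 + v) = m (4 * n + 17 + v)) ->
     m' (6 * n + 17 + u) = m (6 * n + 17 + u) - l ->
     (forall v, v < 2 * n -> v <> u -> m' (6 * n + 17 + v) = m (6 * n + 17 + v)) ->
     (forall a, 8 * n + 17 <= a < q -> m' a = m a) -> Q m' t') ->
  wp W prog_remove m (19 + t) Q.
Proof.
move=> W_lin [r2 r4 r5] m0 m6 m67 m7 ml mu r7 ln un ul Qpost bW.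
have bu := bW (4 * n + 17 + u); have bs := bW (6 * n + 17 + u); have b13 := bW 13.
move: bW; rewrite -/(wp W prog_remove m (19 + t) Q); apply: wp_hold; rewrite /prog_remove.
do 13 assign.
branch; [move=> c1; branch; [move=> c2; do 2 assign | move=> c2] | move=> c1].
- apply: wp_skip; apply: Qpost => //; try by [lia | split; read | read |
    move=> *; read | read; case: eqP; lia].
- do 2 apply: wp_skip; apply: Qpost => //; try by [lia | split; read | read |
    move=> *; read | read; case: eqP; lia].
- do 2 apply: wp_skip; apply: Qpost => //; try by [lia | split; read | read |
    move=> *; read | read; case: eqP; lia].
Qed.

(** * One round of leaf removal *)

Section Rounds.
Variables (n W : nat) (e : rel 'I_n).
Hypotheses (eF : forest e) (W_large : 12 * n + 40 + 2 * n * n <= W).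

Let eS : symmetric e := proj1 (proj1 eF).
Let eI : irreflexive e := proj2 (proj1 eF).

Implicit Types (A B : {set 'I_n}) (qs rs ns : seq 'I_n).

Definition nbr_sum A (x : 'I_n) := \sum_(y in nbrs e A x) y.

(** Every removed vertex has left the queue once, which ties the head of the queue to cell 0.
    Degrees outside [A] are 0, so the final maximum can be taken over the whole array. *)
Definition stores (m : memory) A qs : Prop :=
  [/\ regs n m,
      [/\ m 0 + #|A| = n, m 6 = 8 * n + 17 + m 0, m 7 = m 6 + size qs & m 13 = 2 * #|A|],
      forall x : 'I_n, m (4 * n + 17 + x) = (if x \in A then #|nbrs e A x| else 0),
      forall x, x \in A -> m (6 * n + 17 + x) = nbr_sum A x &
      (forall j, j < size qs -> m (m 6 + j) = nth 0 (map val qs) j) /\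
      (forall v, n <= v < 2 * n -> m (4 * n + 17 + v) = 0)].

Lemma uniq_ord_size qs : uniq qs -> size qs <= n.
Proof. by move=> /card_uniqP <-; rewrite -[leqRHS]card_ord max_card. Qed.

(** State in the middle of a round: [B] is what is left, [rs] the old leaves still to go, [ns] the
    vertices queued for the next round. Degree at most 1, rather than equal to 1, allows for a
    [peel e A] with a single vertex, whose degree falls to 0. *)
Definition in_round A B rs ns : Prop :=
  [/\ peel e A \subset B, B \subset A,
      uniq rs /\ forall x, (x \in rs) = (x \in leaves e A) && (x \in B) &
      uniq ns /\ forall x, (x \in ns) = (x \in peel e A) && (#|nbrs e B x| <= 1)].

Section Step.
Variables (A B : {set 'I_n}) (l : 'I_n) (rs ns : seq 'I_n).
Hypotheses (tA : subtree e A) (A3 : 2 < #|A|).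
Hypothesis rnd : in_round A B (l :: rs) ns.

Lemma round_nbr : exists2 u, u \in peel e A & nbrs e B l = [set u].
Proof.
case: rnd => PB BA [_ rsE] _; have := rsE l; rewrite mem_head => /esym/andP[ll lB].
have lA := subsetP BA l lB.
have [u ilu] := subtree_nbr tA (ltnW A3) lA; exists u; first exact: leaf_nbr_peel ilu.
have uP := leaf_nbr_peel eF tA A3 ll ilu.
apply/setP => x; rewrite !inE; apply/andP/eqP => [[xB elx]|->].
  by apply: (leaf_nbr ll _ ilu); rewrite /induced /= lA elx (subsetP BA).
by split; [apply: (subsetP PB) | case/and3P: ilu].
Qed.

Lemma round_step u : u \in peel e A -> nbrs e B l = [set u] ->
  in_round A (B :\ l) rs (if #|nbrs e (B :\ l) u| == 1 then rcons ns u else ns) /\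
  [/\ l \in B, u \in B :\ l, l \in nbrs e B u & forall x, x \in B -> x != u ->
      nbrs e (B :\ l) x = nbrs e B x].
Proof.
move=> uP nl; case: rnd => PB BA [/= /andP[lrs urs] rsE] [uns nsE].
have := rsE l; rewrite mem_head => /esym/andP[ll lB].
have uB := subsetP PB u uP.
have /setIdP[_ elu] : u \in nbrs e B l by rewrite nl inE.
have nul : u != l by apply: contraTneq uP => ->; rewrite in_setD ll.
have lN : l \in nbrs e B u by rewrite inE lB eS.
have other x : x \in B -> x != u -> nbrs e (B :\ l) x = nbrs e B x.
  move=> xB nx; rewrite nbrs_D1; apply/setP => y; rewrite in_setD1.
  case: (eqVneq y l) => [->|//]; rewrite inE lB /=; apply/esym/negbTE.
  apply: contra nx; rewrite eS => elx; have : x \in nbrs e B l by rewrite inE xB.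
  by rewrite nl inE.
have cu : #|nbrs e B u| = #|nbrs e (B :\ l) u|.+1 by rewrite nbrs_D1 (cardsD1 l) lN.
split; last by rewrite in_setD1 nul uB.
split.
- apply/subsetP => x xP; rewrite in_setD1 (subsetP PB) // andbT.
  by apply: contraTneq xP => ->; rewrite in_setD ll.
- exact: subset_trans (subsetDl _ _) BA.
- split=> // x; rewrite in_setD1; have := rsE x; rewrite inE.
  by case: (eqVneq x l) => [->|] //=; rewrite (negbTE lrs) andbF.
have uE x : x \in peel e A -> x != u -> (#|nbrs e (B :\ l) x| <= 1) = (#|nbrs e B x| <= 1).
  by move=> xP nx; rewrite other // (subsetP PB).
(* If the new degree of [u] is 0, the old one was 1 and [u] is already queued; this rules out
   duplicates. *)
have nsu : (u \in ns) = (#|nbrs e (B :\ l) u| == 0) by rewrite nsE uP cu /= ltnS leqn0.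
case: eqP => [c1|n1].
  rewrite rcons_uniq nsu c1 uns; split=> // x; rewrite mem_rcons inE nsE.
  case: (eqVneq x u) => [->|nx] /=; first by rewrite uP c1.
  by case xP: (x \in peel e A) => //=; rewrite uE.
split=> // x; case: (eqVneq x u) => [->|nx].
  by rewrite nsu uP /=; case: #|_| n1 => [|[]].
by rewrite nsE; case xP: (x \in peel e A) => //=; rewrite uE.
Qed.

End Step.

Lemma wp_round (m : memory) t (Q : memory -> nat -> Prop) A qs :
  subtree e A -> 2 < #|A| -> uniq qs -> qs =i leaves e A -> stores m A qs ->
  22 * #|leaves e A| + 3 <= t ->
  (forall (m' : memory) t' ns, t <= t' + 22 * #|leaves e A| + 3 -> m' 3 = m 3 ->
     stores m' (peel e A) ns -> uniq ns ->
     (forall x, (x \in ns) = (x \in peel e A) && (#|nbrs e (peel e A) x| <= 1)) ->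
     Q m' t') ->
  wp W prog_round m t Q.
Proof.
move=> tA A3 uqs qsE st lt_t Qpost; rewrite /prog_round.
have sz_qs : size qs = #|leaves e A| by rewrite -(card_uniqP uqs); apply: eq_card.
have An : #|A| <= n by rewrite -[leqRHS]card_ord max_card.
have qsn := uniq_ord_size uqs.
case: (st) => -[r2 r4 r5] [r0 r6 r7 r13] rd rs [rq rz].
have Et : t = 1 + (t - 1) by lia.
rewrite {1}Et; assign.
apply: (wp_while (I := fun m' t' => exists B rs ns,
   [/\ t <= t' + 1 + 22 * (size qs - size rs) /\ size rs <= size qs,
       in_round A B rs ns, m' 3 = m 3, m' 8 = m' 6 + size rs - 1 &
       stores m' B (rs ++ ns)])).
- exists A, qs, [::]; rewrite cats0; split; first by lia.
  + split=> //; first exact: peel_subset.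
      split=> // x; rewrite qsE; case xl: (x \in leaves e A) => //=.
      by case/setIdP: xl => ->.
    (* At the start nothing is queued for the next round, since a vertex of [A] that is not a leaf
       has degree at least 2. *)
    split=> // x; apply/esym/negbTE/negP => /andP[xP]; rewrite leqNgt => /negP[].
    move: xP; rewrite in_setD => /andP[nxl xA].
    have [y /and3P[_ yA exy]] := subtree_nbr tA (ltnW A3) xA.
    have c0 : 0 < #|nbrs e A x| by apply/card_gt0P; exists y; rewrite inE yA.
    by move: nxl; rewrite inE xA /=; case: #|_| c0 => [|[]].
  + by read.
  + by read; lia.
  split; try by [split; read; lia | move=> x; read; apply: rd |
    move=> x xA; read; apply: rs].
  split=> [j lj|v lv]; read; [|exact: rz].
  by rewrite -r6; apply: rq.
- move=> m' t' [B [rs' [ns [[lt le] _ _ _ _]]]]; lia.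
- move=> m' t' [B [[|l rs'] [ns [[lt le] rnd s3 s8 st']]]] /=.
    by case: st' => _ [_ s6 _ _] _ _ _; rewrite s8 s6 /= addn0; lia.
  case: (st') => -[s2 s4 s5] [s0 s6 s7 s13] sd ss [sq sz] _.
  have [u uP nl] := round_nbr tA A3 rnd.
  have [rnd' [lB uB' lNu other]] := round_step rnd uP nl.
  have [_ _ [urs _] [uns _]] := rnd.
  have rsn := uniq_ord_size urs; have nsn := uniq_ord_size uns.
  have cB : #|B| = #|B :\ l|.+1 by rewrite (cardsD1 l) lB.
  have uB : u \in B by move: uB'; rewrite in_setD1 => /andP[].
  have nul : u != l by move: uB'; rewrite in_setD1 => /andP[].
  have cu : #|nbrs e B u| = #|nbrs e (B :\ l) u|.+1 by rewrite nbrs_D1 (cardsD1 l) lNu.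
  have su : nbr_sum B u = nbr_sum (B :\ l) u + l.
    by rewrite /nbr_sum nbrs_D1 (big_setD1 l) //= addnC.
  have sl : nbr_sum B l = u by rewrite /nbr_sum nl big_set1.
  have mq : m' (8 * n + 17 + m' 0) = l.
    by have := sq 0 isT; rewrite addn0 s6.
  have ml : m' (6 * n + 17 + l) = u by rewrite ss // sl.
  have mu : m' (6 * n + 17 + u) = nbr_sum (B :\ l) u + l by rewrite ss // su.
  have du : m' (4 * n + 17 + u) = #|nbrs e (B :\ l) u|.+1 by rewrite sd uB cu.
  have ul : (u : nat) <> l by move=> /val_inj/eqP; apply/negP.
  have un := ltn_ord u; have ln := ltn_ord l.
  rewrite /= in lt le rsn s8 s7.
  have -> : t'.-2 = 19 + (t' - 21).
    by move: lt le; rewrite sz_qs; move: lt_t; clear; lia.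
  have Bn : #|B| <= n by rewrite -[leqRHS]card_ord max_card.
  apply: (wp_remove (n := n) (l := l) (u := u) (q := m' 7)) => //.
  + by move: W_large; clear; lia.
  + by move: s0; clear; lia.
  + by rewrite s6; clear; lia.
  + by rewrite s7; clear; lia.
  + rewrite s7 s6 size_cat; move: s0 rsn nsn; clear; lia.
  + by rewrite s6.
  move=> m1 t1 le1 rm1 q0 q3 q6 q8 q13 q7 qu dl1 du1 do1 su1 so1 old.
  set ns' := if _ then _ else ns in rnd'.
  have sns : size ns' = if #|nbrs e (B :\ l) u| == 1 then size ns + 1 else size ns.
    by rewrite /ns'; case: ifP => _; rewrite ?size_rcons ?addn1.
  rewrite du in q7 qu du1; rewrite subn1 /= in q7 qu du1.
  have q7' : m1 7 = m1 6 + size (rs' ++ ns').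
    rewrite q7 q6 s7 !size_cat sns; case: ifP => _; clear; lia.
  exists (B :\ l), rs', ns'; split=> //.
  + by move: lt le le1; clear; lia.
  + by rewrite q3.
  + by rewrite q8 q6 s8; clear; lia.
  split=> //.
  + split=> //; last by rewrite q13 s13 cB; clear; lia.
      by rewrite q0; move: s0; rewrite cB; clear; lia.
    by rewrite q6 s6 q0; clear; lia.
  + move=> x; rewrite in_setD1; case: (eqVneq x l) => [->//|nxl] /=.
    case: (eqVneq x u) => [->|nxu]; first by rewrite du1 uB.
    rewrite do1 ?sd; first by case: ifP => // xB; rewrite other.
    * by have := ltn_ord x; clear; lia.
    * by move=> /val_inj/eqP; apply/negP.
    * by move=> /val_inj/eqP; apply/negP.
  + move=> x; rewrite in_setD1 => /andP[nxl xB].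
    case: (eqVneq x u) => [->|nxu]; first by rewrite su1 mu addnK.
    rewrite so1 ?ss //; first by rewrite /nbr_sum other.
    * by have := ltn_ord x; clear; lia.
    * by move=> /val_inj/eqP; apply/negP.
  split=> [j lj|v lv]; last first.
    rewrite do1 ?sz //; move: lv un ln; clear; lia.
  rewrite q6 map_cat nth_cat size_map; move: lj; rewrite size_cat => lj.
  have old_q i : i < size rs' + size ns ->
      m1 (m' 6 + 1 + i) = nth 0 [seq \val i | i <- rs' ++ ns] i.
    move=> li; rewrite old; last by rewrite s7 s6 size_cat; move: li; clear; lia.
    rewrite -addnA add1n sq //=; rewrite size_cat ltnS; exact: li.
  case: ltnP => ljr.
    rewrite old_q; last exact: leq_trans ljr (leq_addr _ _).
    by rewrite map_cat nth_cat size_map ljr.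
  have ns'E : {ns' = ns} + {[/\ ns' = rcons ns u & #|nbrs e (B :\ l) u| = 1]}.
    by rewrite /ns'; case: eqP => ?; [right | left].
  case: ns'E => [Ens|[Ens c1]]; rewrite Ens in lj *.
    by rewrite old_q // map_cat nth_cat size_map ltnNge ljr.
  rewrite map_rcons nth_rcons size_map; case: (ltnP (j - size rs') (size ns)) => ljn.
    rewrite old_q; last by move: ljn ljr; clear; lia.
    by rewrite map_cat nth_cat size_map ltnNge ljr.
  rewrite size_rcons in lj.
  have Ej : j = size rs' + size ns.
    move: lj ljr ljn; move: (size rs') (size ns) => a b; clear; lia.
  have -> : j - size rs' == size ns by rewrite Ej; apply/eqP; clear; lia.
  rewrite -[\val u]/(u : nat) -qu //; congr (m1 _); rewrite s7 Ej size_cat; clear; lia.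
- move=> m' t' [B [[|l rs'] [ns [[lt le] rnd s3 s8 st']]]] /=; last first.
    by case: st' => _ [_ s6 _ _] _ _ _; rewrite s8 /=; lia.
  move=> _; have [PB BA [_ rsE] [uns nsE]] := rnd.
  have EB : B = peel e A.
    apply/eqP; rewrite eqEsubset PB andbT; apply/subsetP => x xB.
    by rewrite in_setD (subsetP BA) // andbT; have := rsE x; rewrite xB andbT => <-.
  rewrite EB in nsE st'; apply: (Qpost _ _ ns) => //.
  by move: lt; rewrite -sz_qs /= subn0; move: (size qs) => L; clear; lia.
Qed.

End Rounds.

(** Register 13 is twice the number of vertices, so the comparison with 5 tests for at most two
    vertices. Setting [k] to 2 then ends the loop without changing the value. *)
Definition prog_main :=
  CWhile (Imm 3) (reg 3)
    (CIf (reg 13) (Imm 5)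
       (CMov (Dir 3) (Imm 2))
       (prog_round ;; CSub (Dir 3) (reg 3) (Imm 2))).

(** For [k = 1] the maximum degree is capped at 1. Cell 0 already holds the number of leaves removed
    in all rounds. *)
Definition prog_final :=
  prog_max ;;
  CIf (reg 3) (Imm 1) (CIf (Imm 2) (reg 14) (CMov (Dir 14) (Imm 1)) CSkip) CSkip ;;
  CAdd (Dir 0) (reg 0) (reg 14).

Definition prog_cc :=
  prog_move ;; prog_setup ;; prog_edges ;; prog_leaves ;; prog_main ;; prog_final.

(** * The sequence of rounds and the final value *)

Section Main.
Variables (n W : nat) (e : rel 'I_n).
Hypotheses (eF : forest e) (n_gt0 : 0 < n) (W_large : 12 * n + 40 + 2 * n * n <= W).

Implicit Types (A : {set 'I_n}) (qs ns : seq 'I_n).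

Lemma card_peel A : #|peel e A| + #|leaves e A| = #|A|.
Proof.
rewrite addnC -(cardsID (leaves e A) A); congr (_ + _).
by rewrite (setIidPr _) //; apply/subsetP => x; case/setIdP.
Qed.

Lemma low_degree_leaves A ns : subtree e A -> 2 < #|A| ->
  (forall x, (x \in ns) = (x \in A) && (#|nbrs e A x| <= 1)) -> ns =i leaves e A.
Proof.
move=> tA A3 nsE x; rewrite nsE inE; case xA: (x \in A) => //=.
have [y /and3P[_ yA exy]] := subtree_nbr tA (ltnW A3) xA.
have : 0 < #|nbrs e A x| by apply/card_gt0P; exists y; rewrite inE yA.
by case: #|_| => [|[]].
Qed.

Lemma stores_upd3 m A qs x : stores e m A qs -> stores e (upd m 3 x) A qs.
Proof.
case=> -[r2 r4 r5] [r0 r6 r7 r13] rd rs [rq rz].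
split; try by [split; read | move=> y; read; apply: rd | move=> y yA; read; apply: rs].
split=> [j lj|v lv]; read; last exact: rz.
by rewrite -r6; apply: rq.
Qed.

Lemma wp_main (m : memory) t (Q : memory -> nat -> Prop) qs :
  subtree e setT -> stores e m setT qs -> uniq qs -> qs =i leaves e setT ->
  0 < m 3 -> 40 * n + 20 <= t ->
  (forall (m' : memory) t' A ns, t <= t' + 40 * n + 20 -> subtree e A -> stores e m' A ns ->
     0 < m' 3 <= 2 ->
     (forall v, cc_value e A (m' 3) v -> cc_value e setT (m 3) (v + m' 0)) -> Q m' t') ->
  wp W prog_main m t Q.
Proof.
move=> tT st uqs qsE k0 lt_t Qpost; rewrite /prog_main.
(* A pass removing [L] leaves takes at most [22 L + 8] steps, within [40 L] because [L] is positive.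
   The extra 10 pays for the one pass that removes nothing and sets [k] to 2. *)
apply: (wp_while (I := fun m' t' => exists A ns,
   [/\ t <= t' + 40 * (n - #|A|) + (if m' 3 <= 2 then 10 else 0) /\ #|A| <= n,
       subtree e A, stores e m' A ns /\ (2 < #|A| -> uniq ns /\ ns =i leaves e A), 0 < m' 3 &
       forall v, cc_value e A (m' 3) v -> cc_value e setT (m 3) (v + m' 0)])).
- exists setT, qs; rewrite cardsT card_ord; split=> //; first by case: ifP; lia.
  have -> : m 0 = 0.
    by case: st => _ [+ _ _ _] _ _ _; rewrite cardsT card_ord; lia.
  by move=> v; rewrite addn0.
- by move=> m' t' [A [ns [[lt le] [A0 _] _ _ _]]]; move: lt; case: ifP; lia.
- move=> m' t' [A [ns [[lt le] tA [st' leafs] k'0 val]]] /= k3.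
  have nle : (m' 3 <= 2) = false by rewrite leqNgt k3.
  rewrite nle addn0 in lt.
  have r13 : m' 13 = 2 * #|A| by case: st' => _ [].
  have r0 : m' 0 + #|A| = n by case: st' => _ [].
  have A0 : 0 < #|A| by case: tA.
  have -> : t'.-2 = 3 + (t' - 5) by move: lt lt_t le A0; move: #|A| => a; lia.
  apply: wp_hold; apply: wp_if => /=; rewrite r13 => cmp.
    assign; apply: wp_skip; exists A, ns; split; read => //.
    + by split=> //=; move: lt lt_t le A0; move: #|A| => a; lia.
    + by split=> //; apply: stores_upd3.
    move=> v; read => cc2; apply: val; apply: (cc_value_small _ (ltnW k3) cc2).
    by move: cmp; move: #|A| => a; lia.
  have A3 : 2 < #|A| by move: cmp; move: #|A| => a; lia.
  have [uns nsE] := leafs A3.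
  have L0 := subtree_has_leaf eF tA (ltnW A3).
  have LA := card_peel A.
  have small : 22 * #|leaves e A| + 13 <= t'.
    by move: lt lt_t le A3 LA L0; move: #|A| #|leaves e A| #|peel e A| => a b c; lia.
  apply: wp_seq; apply: (wp_round eF W_large tA A3 uns nsE st'); first by lia.
  move=> m1 t1 ns1 le1 q3 st1 uns1 ns1E.
  have -> : t1 = 1 + t1.-1 by lia.
  have b3 : bounded W m1 -> m1 3 <= W by apply.
  move=> bW; have {}b3 := b3 bW; move: bW.
  assign; apply: wp_skip.
  have tP := subtree_peel eF tA A3.
  exists (peel e A), ns1; split; read => //.
  + split; last first.
      by move: le LA; move: #|A| #|leaves e A| #|peel e A| => a b c; lia.
    move: lt le1 le LA L0; move: #|A| #|leaves e A| #|peel e A| => a b c lt le1 le LA L0.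
    by apply: leq_trans (leq_addr _ _); lia.
  + split; first exact: stores_upd3.
    by move=> P3; split=> //; apply: low_degree_leaves.
  + by lia.
  (* The leaves of [A] added by [cc_value_peel] are exactly the increase of cell 0 during the
     round. *)
  move=> v ccv; have := cc_value_peel eF tA A3 k3 ccv => /val.
  have s0 : m1 0 + #|peel e A| = n by case: st1 => _ [].
  congr (cc_value _ _ _ _).
  by move: s0 r0 LA; move: #|A| #|leaves e A| #|peel e A| => a b c; lia.
- move=> m' t' [A [ns [[lt le] tA [st' leafs] k'0 val]]] /= k3.
  have A0 : 0 < #|A| by case: tA.
  apply: Qpost tA st' _ val; last by lia.
  move: lt A0 lt_t; case: ifP => _; move: #|A| => a; lia.
Qed.

Lemma stores_maxdeg m A ns M : stores e m A ns ->
  (forall v, v < 2 * n -> m (4 * n + 17 + v) <= M) ->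
  (M = 0 \/ exists2 v, v < 2 * n & M = m (4 * n + 17 + v)) -> M = maxdeg e A.
Proof.
case=> _ _ rd _ [_ rz] ub att; apply/eqP; rewrite eqn_leq; apply/andP; split; last first.
  apply/bigmax_leqP => x xA; have := ub x; rewrite rd xA; apply.
  by have := ltn_ord x; lia.
case: att => [->//|[v lv ->]]; case: (ltnP v n) => vn; last by rewrite rz // vn lv.
rewrite -[v]/(val (Ordinal vn)) rd; case: ifP => // xA; exact: leq_bigmax_cond.
Qed.

Lemma wp_final (m : memory) t A ns k (Q : memory -> nat -> Prop) :
  subtree e A -> stores e m A ns -> 0 < m 3 <= 2 -> 18 * n + 20 <= t ->
  (forall v, cc_value e A (m 3) v -> cc_value e setT k (v + m 0)) ->
  (forall (m' : memory) t', cc_value e setT k (m' 0) -> Q m' t') ->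
  wp W prog_final m t Q.
Proof.
move=> tA st k12 lt_t val Qpost; rewrite /prog_final; apply: wp_seq.
case: (st) => rm [r0 _ _ _] _ _ _.
apply: (wp_max n_gt0 W_large rm); first by lia.
move=> m1 t1 le1 q0 q3 ub att; have Emax := stores_maxdeg st ub att.
have dn : maxdeg e A <= n.
  by apply/bigmax_leqP => x _; rewrite -[leqRHS]card_ord max_card.
rewrite -Emax in dn.
have cc1 v : m 3 = 1 -> v = minn 1 (m1 14) -> cc_value e setT k (m 0 + v).
  by move=> k1 ->; rewrite addnC; apply: val; rewrite k1 Emax; apply: cc_value_one.
have cc2 : m 3 = 2 -> cc_value e setT k (m 0 + maxdeg e A).
  by move=> k2; rewrite addnC; apply: val; rewrite k2; apply: cc_value_two.
have -> : t1 = 6 + (t1 - 6) by lia.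
apply: wp_hold; branch; [move=> c1; branch; move=> c2 | move=> c1].
- do 2 assign; apply: wp_skip; apply: Qpost; read; apply: cc1; lia.
- apply: wp_skip; assign; apply: wp_skip; apply: Qpost; read; apply: cc1; lia.
- apply: wp_skip; assign; apply: wp_skip; apply: Qpost; read; apply: cc2; lia.
Qed.

End Main.

(** * Correctness of the program on tree inputs *)

Section Input.
Variables (n k : nat) (e : rel 'I_n) (es : seq ('I_n * 'I_n)).
Hypotheses (eT : is_tree e) (esE : edge_list e es).

Let eF : forest e.
Proof. by case: eT. Qed.

Let ps := [seq (val p.1, val p.2) | p <- es].

Lemma tree_subtree : subtree e setT.
Proof.
case: eT => n0 _ conn _; split=> [|x y _ _]; first by rewrite cardsT.
rewrite (eq_connect (e' := e)) // => a b; by rewrite /induced /= !inE.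
Qed.

Lemma size_edge_list : size es = n.-1.
Proof.
have := perm_size esE; rewrite size_map -cardE => ->.
have := subtree_card_edges eF tree_subtree; rewrite cardsT card_ord => <-.
apply: eq_card => E; apply/edge_setP/edge_setP => -[x [y [exy ->]]]; exists x, y; split=> //.
  by rewrite /induced /= !inE.
by case/and3P: exy.
Qed.

Lemma tree_input_pair i : i < size es ->
  nth 0 (tree_input k es) (2 + 2 * i) = (nth (0, 0) ps i).1 /\
  nth 0 (tree_input k es) (3 + 2 * i) = (nth (0, 0) ps i).2.
Proof.
rewrite !addSn !add0n /= /ps; elim: es i => // p s IHs [|i] // lt.
by rewrite mulnS !addSn add0n; exact: IHs.
Qed.

Lemma size_tree_input : size (tree_input k es) = 2 + 2 * size es.
Proof. by rewrite /tree_input /=; elim: es => //= p s ->; lia. Qed.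

Lemma incident_ord F (x : 'I_n) :
  incident F ps x = \sum_(w in nbrs e setT x) F w.
Proof.
by rewrite -(sum_incident_edges eF (fun y : 'I_n => F y) x esE) /incident big_map.
Qed.

Lemma incident_large F v : n <= v -> incident F ps v = 0.
Proof.
move=> nv; rewrite /incident big_map big1_seq // => p _ /=.
have ne (x : 'I_n) : (x == v :> nat) = false.
  by apply/eqP => E; have := ltn_ord x; rewrite E ltnNge nv.
by rewrite !ne.
Qed.

(** The credits of the phases add up to [106 n + 71], which is below [200 n] because a tree has a
    vertex. *)
Lemma prog_cc_correct W : 0 < k -> k <= W -> 12 * n + 40 + 2 * n * n <= W ->
  bounded W (nth 0 (tree_input k es)) ->
  wp W prog_cc (nth 0 (tree_input k es)) (200 * n) (fun m _ => is_cc e k (m 0)).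
Proof.
move=> k0 kW W_large bW.
have n0 : 0 < n by case: eT; rewrite card_ord.
have sz := size_edge_list.
have psz : size ps = n.-1 by rewrite size_map.
have ps_lt : all (fun p => (p.1 < n) && (p.2 < n)) ps.
  by apply/allP => p /mapP[q _ ->]; rewrite /= !ltn_ord.
have ps_neq : all (fun p => p.1 != p.2) ps.
  apply/allP => p /mapP[q /(edge_list_edge eF esE) eq ->] /=.
  by apply: contraTneq eq => /val_inj->; rewrite (proj2 (proj1 eF)).
set m0 := nth 0 _ in bW *.
rewrite /prog_cc; apply: wp_seq; apply: (wp_move n0 W_large) => //; try lia.
  by move=> a la; rewrite /m0 nth_default // size_tree_input sz; lia.
move=> m1 t1 le1 q1 edges qk zero.
apply: wp_seq; apply: (wp_setup n0 W_large) => //; try lia; first by rewrite qk.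
move=> m2 rm2 s3 s6 s7 s13 s9 s8 old.
apply: wp_seq; apply: (wp_edges n0 W_large psz ps_lt ps_neq) => //; try lia.
- move=> i li; have [E _] := tree_input_pair (ltac:(by rewrite size_map in li) : i < size es).
  rewrite -E old; last by lia.
  have -> : 2 * n + 18 + 2 * i = 2 * n + 16 + (2 + 2 * i) by lia.
  by rewrite edges //; lia.
- move=> i li; have [_ E] := tree_input_pair (ltac:(by rewrite size_map in li) : i < size es).
  rewrite -E old; last by lia.
  have -> : 2 * n + 19 + 2 * i = 2 * n + 16 + (3 + 2 * i) by lia.
  by rewrite edges //; lia.
- by move=> a la; rewrite old ?zero //; lia.
move=> m3 t3 le3 rm3 u3 u6 u7 u13 deg sum.
apply: wp_seq; apply: (wp_leaves n0 W_large rm3); [by rewrite u7 | by lia |].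
move=> m4 t4 le4 rm4 v0 v3 v6 v13 old4 qn v7 queue.
have degE (x : 'I_n) : m3 (4 * n + 17 + x) = #|nbrs e setT x|.
  by rewrite deg ?incident_ord ?sum1_card //; have := ltn_ord x; lia.
pose qs := [seq x <- enum 'I_n | m3 (4 * n + 17 + val x) == 1].
have qsE : qn = map val qs.
  (* The scan covers [2n] entries; those from [n] on belong to no vertex, hold 0 and contribute no
     leaf. *)
  rewrite /qn (_ : 2 * n = n + n); last by lia.
  rewrite iotaD filter_cat [X in _ ++ X](_ : _ = [::]) ?cats0; last first.
    apply/eqP; rewrite -[_ == _]negbK -has_filter; apply/hasPn => v.
    by rewrite mem_iota => lv; rewrite deg ?incident_large //; lia.
  by rewrite -val_enum_ord filter_map.
have st : stores e m4 setT qs.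
  split=> //.
  - rewrite cardsT card_ord v0 v6 u6 s6 v7 v13 u13 s13 qsE size_map; split=> //; lia.
  - by move=> x; rewrite inE old4 ?degE //; have := ltn_ord x; lia.
  - move=> x _; rewrite old4; last by have := ltn_ord x; lia.
    by rewrite sum ?incident_ord //; have := ltn_ord x; lia.
  split=> [j lj|v lv]; last by rewrite old4 ?deg ?incident_large //; lia.
  by rewrite v6 u6 s6 queue qsE ?size_map.
apply: wp_seq; apply: (wp_main (qs := qs) eF n0 W_large tree_subtree st).
- by rewrite filter_uniq ?enum_uniq.
- by move=> x; rewrite mem_filter mem_enum andbT degE !inE.
- by rewrite v3 u3 s3 qk.
- lia.
move=> m5 t5 A ns le5 tA st5 k12 val5.
rewrite v3 u3 s3 qk -[m0 1]/k in val5.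
apply: (wp_final eF n0 W_large tA st5 k12 _ val5); first by lia.
by move=> m6 t6; apply: cc_value_is_cc.
Qed.

End Input.

Theorem theorem5p2 :
  exists (P : program) (C c : nat),
  forall (n k : nat) (e : rel 'I_n) (es : seq ('I_n * 'I_n)),
    is_tree e -> 0 < k -> edge_list e es ->
    exists2 m, is_cc e k m
             & ram_computes P (tree_input k es) (C * n) ((n + k + 1) ^ c) m.
Proof.
exists (compile 0 prog_cc), 200, 5 => n k e es eT k0 esE.
set W := (n + k + 1) ^ 5.
have n0 : 0 < n by case: eT; rewrite card_ord.
(* Since [n + k + 1 >= 3], three of the five factors provide the constant 27, which absorbs the
   coefficients of the quadratic bound on addresses and sums. *)
have W2 : 27 * ((n + k + 1) * (n + k + 1)) <= W.
  rewrite /W (_ : 5 = 3 + 2) // expnD mulnn leq_mul2r (_ : 27 = 3 ^ 3) // leq_exp2r //.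
  by apply/orP; right; lia.
have sq : (n + 2) * (n + 2) <= (n + k + 1) * (n + k + 1) by apply: leq_mul; lia.
have W_large : 12 * n + 40 + 2 * n * n <= W.
  by apply: leq_trans W2; move: sq; clear; lia.
have kW : k <= W.
  apply: leq_trans W2; apply: leq_trans (leq_pmull _ _) => //.
  by apply: leq_trans (leq_pmull _ _); lia.
have bW : bounded W (nth 0 (tree_input k es)).
  case=> [|[|a]] //=; first by lia.
  case: (ltnP a (size (flatten [seq [:: val p.1; val p.2] | p <- es]))) => [lt|le].
    have := mem_nth 0 lt; case/flattenP=> s /mapP[p _ ->].
    rewrite !inE => /orP[]/eqP->; [have := ltn_ord p.1|have := ltn_ord p.2]; rewrite /=; lia.
  by rewrite nth_default.
apply: wp_ram_computes => //; exact: prog_cc_correct.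
Qed.
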